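(* Let $R_1$ and $R_2$ be non-constant rational maps and let $G_1$ and $G_2$ be the respective sandwich semigroups on $Rat(\mathbb C)$. Then: (1) The pair $R_1,R_2$ belongs to the same conformal Hurwitz class if and only if there exists a continuous orientation preserving isomorphism $\rho:G_1\to G_2$. Moreover, $\rho(\mathrm{Id})=\mathrm{Id}$ if and only if $R_1$ is $PSL(2,\mathbb C)$-conjugated to $R_2$. (2) A continuous isomorphism $\rho$ reverses orientation if and only if $R_1$ is an anticonformal copy of $R_2$. Moreover, $\rho(\mathrm{Id})=\mathrm{Id}$ if and only if $R_1$ is anticonformally conjugated to $R_2$.
   Context: $Rat(\mathbb C)$ is the set of all rational maps $\overline{\mathbb C}\to\overline{\mathbb C}$, including the constant maps, regarded as a subset of the topological semigroup $End(\overline{\mathbb C})$ of continuous self-maps of the Riemann sphere. For a rational map $R_i$, the sandwich product with respect to $R_i$ is $g_1\ast_{R_i}g_2=g_1\circ R_i\circ g_2$, and $G_i=\langle Rat(\mathbb C),\ast_{R_i}\rangle$ is the corresponding sandwich semigroup. The sphere $\overline{\mathbb C}$ is identified with the set of constant maps. An isomorphism $\rho:G_1\to G_2$ maps constants to constants and thus induces a bijection $f=\rho|_{\overline{\mathbb C}}:\overline{\mathbb C}\to\overline{\mathbb C}$; $\rho$ is called orientation preserving or orientation reversing according to whether $f$ has the corresponding property. $R_1$ and $R_2$ belong to the same conformal Hurwitz class if there are $g,h\in PSL(2,\mathbb C)$ with $R_2=g^{-1}\circ R_1\circ h$. $R_1$ is an anticonformal copy of $R_2$ if there are anticonformal homeomorphisms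 $\alpha,\beta:\overline{\mathbb C}\to\overline{\mathbb C}$ with $\beta\circ R_1=R_2\circ\alpha$; it is anticonformally conjugated to $R_2$ if one can take $\alpha=\beta$. *)

(* Defs.v *)
From HB Require Import structures.
From mathcomp Require Import all_boot all_order all_algebra.
From mathcomp Require Import complex.
From mathcomp Require Import all_classical all_reals all_analysis.

Set Implicit Arguments.
Unset Strict Implicit.
Unset Printing Implicit Defensive.

Import Order.TTheory GRing.Theory Num.Theory.
Import numFieldNormedType.Exports.

Local Open Scope classical_set_scope.
Local Open Scope complex_scope.
Local Open Scope ring_scope.

(* [Some z] is the finite point [z], [None] is the point at infinity. *)
Notation sphere R := (one_point_compactification R[i]^o).

(* The topology of uniform convergence, the sphere being compact. *)
Notation sphere_maps R := {compact-open, sphere R -> sphere R}.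

Section RationalMaps.
Variable R : realType.
Implicit Types (f g h : sphere R -> sphere R) (p q : {poly R[i]}).

(* The extension of [p / q] to the sphere, for coprime [p] and [q]. At infinity
   it is the quotient of the coefficients of degree [max (deg p) (deg q)].
   The constant map at infinity is [ratmap 1 0]. *)
Definition ratmap p q (x : sphere R) : sphere R :=
  match x with
  | Some z => if q.[z] == 0 then None else Some (p.[z] / q.[z])
  | None => if (size q < size p)%N then None
            else Some (p`_(size q).-1 / lead_coef q)
  end.

Definition RatMaps : set (sphere_maps R) :=
  [set f | exists p q, coprimep p q /\ f = ratmap p q].

Definition nonconstant f := ~ exists c, f = cst c.

Definition mobius (A : 'M[R[i]]_2) (x : sphere R) : sphere R :=
  match x with
  | Some z => if A 1 0 * z + A 1 1 == 0 then None
              else Some ((A 0 0 * z + A 0 1) / (A 1 0 * z + A 1 1))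
  | None => if A 1 0 == 0 then None else Some (A 0 0 / A 1 0)
  end.

Definition PSL2 : set (sphere R -> sphere R) :=
  [set g | exists A : 'M[R[i]]_2, \det A = 1 /\ g = mobius A].

Definition same_conformal_hurwitz_class (R1 R2 : sphere R -> sphere R) :=
  exists g ginv h, [/\ PSL2 g, PSL2 h, cancel g ginv, cancel ginv g
                     & R2 = ginv \o R1 \o h].

Definition PSL2_conjugate (R1 R2 : sphere R -> sphere R) :=
  exists g ginv, [/\ PSL2 g, cancel g ginv, cancel ginv g
                   & R2 = ginv \o R1 \o g].

End RationalMaps.

Section ConformalStructure.
Variable R : realType.
Implicit Types (f : sphere R -> sphere R) (x : sphere R).

Definition inversion x : sphere R :=
  match x with
  | Some z => if z == 0 then None else Some z^-1
  | None => Some 0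
  end.

(* The holomorphic atlas with coordinates [z] and [1 / z]: [x] lies in the
   domain of the chart [b] when [chart b x] is finite, and this value is then
   its coordinate. Each [chart b] is an involution of the sphere, hence also
   serves as the inverse parametrization. *)
Definition chart (b : bool) : sphere R -> sphere R :=
  if b then inversion else id.

(* [f] read in the charts [b] (source) and [b'] (target); the default value is
   irrelevant near a point sent into the domain of [b'] by a continuous [f]. *)
Definition in_charts (b b' : bool) f (z : R[i]) : R[i] :=
  odflt 0 (chart b' (f (chart b (Some z)))).

Definition homeomorphism f :=
  exists g, [/\ continuous f, continuous g, cancel f g & cancel g f].

(* Complex differentiability with nonzero derivative. *)
Definition conformal_at f x :=
  forall (b b' : bool) (z w : R[i]),
    chart b x = Some z -> chart b' (f x) = Some w ->
  exists d : R[i], d != 0 /\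
    is_derive (z : R[i]^o) 1 (in_charts b b' f : R[i]^o -> R[i]^o) d.

Definition conj_sphere : sphere R -> sphere R := omap (@conjc R).

Definition anticonformal_homeomorphism f :=
  homeomorphism f /\ forall x, conformal_at (conj_sphere \o f) x.

Definition anticonformal_copy (R1 R2 : sphere R -> sphere R) :=
  exists alpha beta, [/\ anticonformal_homeomorphism alpha,
    anticonformal_homeomorphism beta & beta \o R1 = R2 \o alpha].

Definition anticonformally_conjugate (R1 R2 : sphere R -> sphere R) :=
  exists alpha, anticonformal_homeomorphism alpha /\
    alpha \o R1 = R2 \o alpha.

End ConformalStructure.

Section Orientation.
Variable R : realType.
Implicit Types (f : sphere R -> sphere R) (x : sphere R).

Definition cis (t : R) : R[i] := cos t +i* sin t.

Definition circle (z : R[i]) (r t : R) : R[i] := z + r%:C * cis (2 * pi * t).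

(* The curve [gamma] on [0, 1] avoids [w] and has winding number [n] about [w];
   [theta] is a continuous determination of the argument of [gamma - w]. *)
Definition winding_number (gamma : R -> R[i]) (w : R[i]) (n : int) :=
  (forall t : R, 0 <= t <= 1 -> gamma t != w) /\
  exists theta : R -> R,
    [/\ {within `[0, 1], continuous theta},
        forall t : R, 0 <= t <= 1 ->
          gamma t - w = `|gamma t - w| * cis (theta t)
      & theta 1 - theta 0 = 2 * pi * n%:~R].

Definition local_degree f x (n : int) :=
  forall (b b' : bool) (z w : R[i]),
    chart b x = Some z -> chart b' (f x) = Some w ->
  \forall r \near (0 : R)^'+,
    winding_number (fun t => in_charts b b' f (circle z r t)) w n.

(* Meant for homeomorphisms, whose local degree is the same, 1 or -1, at every
   point. *)
Definition orientation_preserving f := forall x, local_degree f x 1.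
Definition orientation_reversing f := forall x, local_degree f x (-1).

End Orientation.

Section SandwichSemigroups.
Variable R : realType.
Implicit Types (rho : sphere_maps R -> sphere_maps R).

Definition sandwich (R0 g1 g2 : sphere R -> sphere R) : sphere R -> sphere R :=
  g1 \o R0 \o g2.

(* Only the values of [rho] on [RatMaps R] matter. *)
Definition sandwich_isomorphism (R1 R2 : sphere R -> sphere R) rho :=
  set_bij (@RatMaps R) (@RatMaps R) rho /\
  forall g1 g2, RatMaps g1 -> RatMaps g2 ->
    rho (sandwich R1 g1 g2) = sandwich R2 (rho g1) (rho g2).

(* Continuity is for the subspace topology of [RatMaps R] on the source; on the
   target it is unaffected by corestriction to [RatMaps R]. *)
Definition continuous_isomorphism (R1 R2 : sphere R -> sphere R) rho :=
  sandwich_isomorphism R1 R2 rho /\ {within @RatMaps R, continuous rho}.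

Definition induced_on_constants rho (f : sphere R -> sphere R) :=
  forall c, rho (cst c) = cst (f c).

Definition preserves_orientation rho :=
  exists f, induced_on_constants rho f /\ orientation_preserving f.

Definition reverses_orientation rho :=
  exists f, induced_on_constants rho f /\ orientation_reversing f.

End SandwichSemigroups.

(* Main.v *)
(** Constants are the left zeros of a sandwich semigroup, so an isomorphism
[rho] induces a bijection [f] of the sphere, and evaluating [rho] at
[g \o R1 \o cst c] gives [f \o g \o R1 = rho g \o R2 \o f] for every rational
[g]. With [P = rho id] and [R2] surjective this reads
[f \o g \o f^-1 \o P = rho g]; choosing [rho g = id] shows that [P] is an
injective rational map, hence a homography. So conjugation by [f] maps
homographies to injective rational maps, that is, to homographies. Normalized
to fix 0, 1 and infinity, [f] then conjugates scalings to scalings and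
translations to translations: it is a continuous field automorphism, the
identity or the complex conjugation. Winding numbers separate the two cases.

Conversely [R2 = g^-1 \o R1 \o h] gives [rho k = h^-1 \o k \o g], and
[be \o R1 = R2 \o al] gives [rho k = al \o k \o be^-1]. The latter requires
that conformal homeomorphisms of the sphere be homographies. If [h] is entire
and [h z / z] tends to [c] at infinity, then [z |-> (h (a + z) - h a) / z]
lifted by the exponential is periodic with limits [h' a] and [c] at both ends,
and Goursat's theorem on a period rectangle yields [h' a = c]. *)
Require Import Defs.
From HB Require Import structures.
From mathcomp Require Import all_boot all_order all_algebra.
From mathcomp Require Import complex.
From mathcomp Require Import ring lra zify.
From mathcomp Require Import all_classical all_reals all_analysis.
Import Order.TTheory GRing.Theory Num.Theory.
Import numFieldNormedType.Exports.
Set Implicit Arguments.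
Unset Strict Implicit.
Unset Printing Implicit Defensive.
Local Open Scope classical_set_scope.
Local Open Scope complex_scope.
Local Open Scope ring_scope.

(** * Homographies and rational maps *)

Section Homography.
Variable R : realType.
Implicit Types (a b c d x y z : R[i]) (s t : sphere R) (f g h : sphere R -> sphere R).

(** Continuity of [rho] enters only through [f]: the constants embed the sphere in the compact-open
    topology, so [f] is [rho] on constants followed by evaluation at a point. Without it the wild
    automorphisms of the complex field, applied to coefficients, could not be excluded. Two choices
    shape the rest. Points are written in homogeneous coordinates, so that infinity and poles need
    no separate treatment: a homography is a matrix, a rational map a pair of forms of equal degree.
    And complex integration is reduced to real increments: [G dz] splits into real forms
    [P dx + Q dy], whose integral along a side of a rectangle is the increment of a one-variable
    primitive. The exponential unrolls an annulus around 0 into such a rectangle, so rectangles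
    suffice where circles would be expected. All four equivalences are read off from
    [f \o R1 = P \o R2 \o f]; the homography [P] is what separates two-sided equivalence from
    conjugacy. *)

Definition proj x y : sphere R := if y == 0 then None else Some (x / y).

(** Excludes [proj 0 0], which takes the junk value infinity. *)
Definition nz x y := (x != 0) || (y != 0).

Lemma proj_surj s : exists x y, nz x y /\ s = proj x y.
Proof.
case: s => [z|]; first by exists z, 1; rewrite /nz /proj oner_eq0 orbT divr1.
by exists 1, 0; rewrite /nz /proj oner_eq0 eqxx.
Qed.

Lemma projE z : Some z = proj z 1.
Proof. by rewrite /proj oner_eq0 divr1. Qed.

Lemma projoo : None = proj 1 0.
Proof. by rewrite /proj eqxx. Qed.

Lemma proj_scale k x y : k != 0 -> proj (k * x) (k * y) = proj x y.
Proof.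
move=> k0; rewrite /proj mulf_eq0 (negPf k0) /=.
by case: eqP => // /eqP y0; congr Some; rewrite -mulf_div divff ?mul1r.
Qed.

Definition mob a b c d s : sphere R :=
  match s with
  | Some z => if c * z + d == 0 then None else Some ((a * z + b) / (c * z + d))
  | None => if c == 0 then None else Some (a / c)
  end.

Lemma mobE (A : 'M[R[i]]_2) : mobius A = mob (A 0 0) (A 0 1) (A 1 0) (A 1 1).
Proof. by []. Qed.

(** In homogeneous coordinates the case distinctions of [mob] disappear; composition and inversion
    become identities for [ring]. *)
Lemma mob_proj a b c d x y : nz x y ->
  mob a b c d (proj x y) = proj (a * x + b * y) (c * x + d * y).
Proof.
rewrite /proj /nz; case: (eqVneq y 0) => [->|y0] /=.
  rewrite orbF !mulr0 !addr0 mulf_eq0 => x0; rewrite (negPf x0) orbF.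
  by case: eqP => // /eqP c0; rewrite -mulf_div divff ?mulr1.
move=> _; have -> : c * (x / y) + d = (c * x + d * y) / y by field.
rewrite mulf_eq0 invr_eq0 (negPf y0) orbF; case: eqP => // /eqP e0.
by congr Some; field; rewrite y0 e0.
Qed.

Lemma nz_mob a b c d x y : a * d - b * c != 0 -> nz x y ->
  nz (a * x + b * y) (c * x + d * y).
Proof.
move=> D0; apply: contraTT; rewrite /nz !negb_or !negbK => /andP[/eqP e1 /eqP e2].
(* Cramer's rule: the two combinations recover the determinant times [x] and times [y]. *)
apply/andP; split; apply/eqP; apply: (mulfI D0); rewrite mulr0.
  have -> : (a * d - b * c) * x = d * (a * x + b * y) - b * (c * x + d * y) by ring.
  by rewrite e1 e2 !mulr0 subr0.
have -> : (a * d - b * c) * y = a * (c * x + d * y) - c * (a * x + b * y) by ring.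
by rewrite e1 e2 !mulr0 subr0.
Qed.

Lemma mobM a b c d a' b' c' d' s : a' * d' - b' * c' != 0 ->
  mob a b c d (mob a' b' c' d' s) =
  mob (a * a' + b * c') (a * b' + b * d') (c * a' + d * c') (c * b' + d * d') s.
Proof.
move=> D; have [x [y [n ->]]] := proj_surj s.
rewrite !mob_proj ?nz_mob //; congr proj; ring.
Qed.

Lemma mob_id k s : k != 0 -> mob k 0 0 k s = s.
Proof.
move=> k0; have [x [y [n ->]]] := proj_surj s.
by rewrite mob_proj // !mul0r addr0 add0r proj_scale.
Qed.

Definition isMob f := exists a b c d, a * d - b * c != 0 /\ f = mob a b c d.

Lemma isMob_comp f g : isMob f -> isMob g -> isMob (f \o g).
Proof.
move=> [a [b [c [d [D ->]]]]] [a' [b' [c' [d' [D' ->]]]]].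
do 4 eexists; split; last by apply/funext => s /=; rewrite mobM.
have := mulf_neq0 D D'; congr (_ != 0); ring.
Qed.

Lemma isMob_inv f : isMob f -> exists g, [/\ isMob g, cancel f g & cancel g f].
Proof.
(* The adjugate matrix: multiplied by the original one, it gives the determinant times the identity,
   which acts trivially by [mob_id]. *)
move=> [a [b [c [d [D ->]]]]]; exists (mob d (- b) (- c) a).
have D' : d * a - - b * - c != 0 by move: D; congr (_ != 0); ring.
split; first by do 4 eexists; split; last by [].
- move=> s; rewrite mobM // -[RHS](@mob_id (a * d - b * c)) //.
  by congr mob; ring.
- move=> s; rewrite mobM // -[RHS](@mob_id (a * d - b * c)) //.
  by congr mob; ring.
Qed.

Lemma isMob_id : isMob id.
Proof.
exists 1, 0, 0, 1; split; first by rewrite mulr0 subr0 mulr1 oner_neq0.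
by apply/funext => s; rewrite mob_id ?oner_neq0.
Qed.

Lemma isMob_affine a b : a != 0 -> isMob (mob a b 0 1).
Proof. by move=> a0; exists a, b, 0, 1; rewrite mulr0 subr0 mulr1. Qed.

Lemma mob_affine a b z : mob a b 0 1 (Some z) = Some (a * z + b).
Proof. by rewrite /mob mul0r add0r oner_eq0 divr1. Qed.

Lemma mob_affineoo a b : mob a b 0 1 None = None.
Proof. by rewrite /mob eqxx. Qed.

Lemma inversionE : @inversion R = mob 0 1 1 0.
Proof.
by apply/funext => -[z|] /=; rewrite ?mul1r ?addr0 ?mul0r ?add0r ?div1r ?oner_eq0.
Qed.

Lemma isMob_inversion : isMob (@inversion R).
Proof.
rewrite inversionE; exists 0, 1, 1, 0; split;
  rewrite ?mul0r ?mulr1 ?sub0r ?oppr_eq0 ?oner_neq0 //.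
Qed.

Lemma isMob_chart bb : isMob (@chart R bb).
Proof. by case: bb; [exact: isMob_inversion | exact: isMob_id]. Qed.

Lemma inversionK : involutive (@inversion R).
Proof.
case=> [z|] //=; last by rewrite eqxx.
case: eqP => [->//|/eqP z0] /=.
by rewrite invr_eq0 (negPf z0) invrK.
Qed.

Lemma chartK bb : involutive (@chart R bb).
Proof. by case: bb => //; exact: inversionK. Qed.

Lemma isMob_inj f : isMob f -> injective f.
Proof. by move=> /isMob_inv[g [_ fg _]]; exact: can_inj fg. Qed.

Lemma mob_to0oo s t : s != t -> exists f, [/\ isMob f, f s = Some 0 & f t = None].
Proof.
have [x [y [n ->]]] := proj_surj s; have [x' [y' [n' ->]]] := proj_surj t.
(* The numerator is the linear form vanishing at [s], the denominator the one vanishing at [t]; they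
   are proportional only if the two points coincide. *)
move=> st; exists (mob y (- x) y' (- x')).
have D : x * y' - y * x' != 0.
  apply: contra_neq st => /eqP; rewrite subr_eq0 => /eqP e.
  move: n n'; rewrite /nz /proj.
  case: (eqVneq y 0) e => [->|y0]; case: (eqVneq y' 0) => [->|y0'] //=.
  - rewrite orbF mul0r => /eqP; rewrite mulf_eq0 (negPf y0') orbF => /eqP ->.
    by rewrite eqxx.
  - rewrite mulr0 => /esym/eqP; rewrite mulf_eq0 (negPf y0) => /eqP ->.
    by rewrite eqxx.
  - move=> e _ _; congr Some; apply: (mulIf (mulf_neq0 y0 y0')).
    transitivity (x * y'); first by field.
    by rewrite e; field.
split.
- do 4 eexists; split; last by [].
  by move: D; congr (_ != 0); ring.
- rewrite mob_proj // /proj.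
  case: eqP => e; last by congr Some; rewrite -[X in X / _](_ : 0 = _) ?mul0r //; ring.
  move/eqP: D; case; rewrite -e; ring.
- rewrite mob_proj // /proj.
  by rewrite (_ : y' * x' + _ = 0) ?eqxx //; ring.
Qed.

Lemma det_2x2 (A : 'M[R[i]]_2) : \det A = A 0 0 * A 1 1 - A 0 1 * A 1 0.
Proof.
rewrite (expand_det_row _ 0) !big_ord_recl big_ord0 /cofactor !det_mx11 !mxE /=.
rewrite expr0 expr1 !mul1r addr0 mulN1r mulrN.
by congr (A _ _ * A _ _ - A _ _ * A _ _); apply/val_inj.
Qed.

Lemma PSL2P f : PSL2 f <-> isMob f.
Proof.
split=> [[A [dA ->]]|[a [b [c [d [D ->]]]]]].
  rewrite mobE; do 4 eexists; split; last by [].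
  by rewrite -det_2x2 dA oner_neq0.
(* Scaling a matrix does not change its action; this factor brings the determinant to 1. *)
pose k := (sqrtc (a * d - b * c))^-1.
have k2 : k ^+ 2 = (a * d - b * c)^-1 by rewrite /k exprVn sqr_sqrtc.
have k0 : k != 0.
  by apply: contra_neq D => k0; apply: invr_inj; rewrite -k2 k0 expr0n invr0.
pose A : 'M[R[i]]_2 := \matrix_(i, j)
  if i == 0 then (if j == 0 then k * a else k * b)
  else (if j == 0 then k * c else k * d).
exists A; split.
  rewrite det_2x2 !mxE /=.
  transitivity (k ^+ 2 * (a * d - b * c)); first by ring.
  by rewrite k2 mulVf.
rewrite mobE !mxE /=; apply/funext => s; have [x [y [n ->]]] := proj_surj s.
by rewrite !mob_proj // -!mulrA -!mulrDr proj_scale.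
Qed.

End Homography.

(** * Rational maps as pairs of binary forms *)

Section Rational.
Variable R : realType.
Implicit Types (a b c d x y z : R[i]) (s t : sphere R) (f g h : sphere R -> sphere R).
Implicit Types (p q : {poly R[i]}) (F G : R[i] -> R[i] -> R[i]).

(* [F] is the homogeneous form [sum_i p_i x^i y^(n - i)]. *)
Definition isform n F := exists p, [/\ (size p <= n.+1)%N,
  forall x y, y != 0 -> F x y = y ^+ n * p.[x / y] &
  forall x, F x 0 = p`_n * x ^+ n].

(** The degrees [m] and [n] are formal and may exceed the true ones; the coefficient at the formal
    degree is the value of a form at infinity. *)
Lemma coef_top_mul p q m n : (size p <= m.+1)%N -> (size q <= n.+1)%N ->
  (p * q)`_(m + n) = p`_m * q`_n.
Proof.
move=> sp sq; rewrite coefM.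
have mlt : (m < (m + n).+1)%N by rewrite ltnS leq_addr.
rewrite (bigD1 (Ordinal mlt)) //= addKn big1 ?addr0 // => i.
rewrite -val_eqE /= neq_ltn => /orP[im|mi].
  rewrite [X in _ * X]nth_default ?mulr0 //; apply: (leq_trans sq).
  by rewrite ltn_subRL ltn_add2r.
by rewrite [X in X * _]nth_default ?mul0r //; exact: leq_trans mi.
Qed.

Lemma isformM m n F G : isform m F -> isform n G ->
  isform (m + n) (fun x y => F x y * G x y).
Proof.
move=> [p [sp pF pF0]] [q [sq qG qG0]]; exists (p * q); split.
- apply: leq_trans (size_polyMleq _ _) _.
  by rewrite -subn1 leq_subLR add1n -addnS -addSn leq_add.
- by move=> x y y0; rewrite pF // qG // hornerM exprD mulrACA.
- by move=> x; rewrite pF0 qG0 coef_top_mul // exprD mulrACA.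
Qed.

Lemma isformD n F G : isform n F -> isform n G -> isform n (fun x y => F x y + G x y).
Proof.
move=> [p [sp pF pF0]] [q [sq qG qG0]]; exists (p + q); split.
- by apply: leq_trans (size_polyD _ _) _; rewrite geq_max sp.
- by move=> x y y0; rewrite pF // qG // hornerD mulrDr.
- by move=> x; rewrite pF0 qG0 coefD mulrDl.
Qed.

Lemma isformZ n k F : isform n F -> isform n (fun x y => k * F x y).
Proof.
move=> [p [sp pF pF0]]; exists (k *: p); split.
- exact: leq_trans (size_scale_leq _ _) _.
- by move=> x y y0; rewrite pF // hornerZ mulrCA.
- by move=> x; rewrite pF0 coefZ mulrA.
Qed.

Lemma isform_lin a b : isform 1 (fun x y => a * x + b * y).
Proof.
exists (a *: 'X + b%:P); split.
- apply: leq_trans (size_polyD _ _) _; rewrite geq_max.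
  rewrite (leq_trans (size_scale_leq _ _)) ?size_polyX //.
  by rewrite (leq_trans (size_polyC_leq1 _)).
- by move=> x y y0; rewrite hornerD hornerZ hornerX hornerC; field.
- by move=> x; rewrite mulr0 addr0 coefD coefZ coefX coefC /= mulr1 addr0 expr1.
Qed.

Lemma isform_cst c : isform 0 (fun _ _ => c).
Proof.
exists c%:P; split; first exact: size_polyC_leq1.
- by move=> x y _; rewrite hornerC mul1r.
- by move=> x; rewrite coefC mulr1.
Qed.

Lemma isformX m n F : isform n F -> isform (n * m) (fun x y => F x y ^+ m).
Proof.
move=> hF; elim: m => [|m IH]; first by rewrite muln0; exact: isform_cst.
rewrite mulnS; have := isformM hF IH.
by under eq_fun do under eq_fun do rewrite -exprS.
Qed.

Lemma isform0 n : isform n (fun _ _ => 0).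
Proof.
exists 0; split; rewrite ?size_poly0 //.
- by move=> *; rewrite horner0 mulr0.
- by move=> *; rewrite coef0 mul0r.
Qed.

Lemma isform_sum n m (F : 'I_m -> R[i] -> R[i] -> R[i]) : (forall i, isform n (F i)) ->
  isform n (fun x y => \sum_i F i x y).
Proof.
elim: m F => [|m IH] F hF.
  by under eq_fun do under eq_fun do rewrite big_ord0; exact: isform0.
under eq_fun do under eq_fun do rewrite big_ord_recl.
by apply: isformD => //; exact: IH.
Qed.

(** Written in monomials, a form stays a form under linear substitution because products and powers
    of linear forms are forms. *)
Lemma isformE n F : isform n F ->
  exists e : nat -> R[i], forall x y, F x y = \sum_(i < n.+1) e i * (x ^+ i * y ^+ (n - i)).
Proof.
move=> [p [sp pF pF0]]; exists (fun i => p`_i) => x y.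
case: (eqVneq y 0) => [->|y0].
  rewrite pF0 (bigD1 ord_max) //= subnn expr0 mulr1 big1 ?addr0 // => i.
  rewrite -val_eqE /= => ni; rewrite expr0n subn_eq0 leqNgt ltn_neqAle ni -ltnS ltn_ord.
  by rewrite /= !mulr0.
rewrite pF // (horner_coef_wide _ sp) mulr_sumr; apply: eq_bigr => i _.
rewrite mulrCA; congr (_ * _); rewrite expr_div_n mulrCA; congr (_ * _).
by rewrite expfB_cond ?(negPf y0) //= add0n -ltnS.
Qed.

Lemma isform_subst n F a b c d : isform n F ->
  isform n (fun x y => F (a * x + b * y) (c * x + d * y)).
Proof.
move=> /isformE[e eE]; under eq_fun do under eq_fun do rewrite eE.
apply: isform_sum => i; apply: isformZ.
have := isformM (isformX i (isform_lin a b)) (isformX (n - i) (isform_lin c d)).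
by rewrite !mul1n subnKC // -ltnS.
Qed.

(** Forms of equal degree without common zero describe the map uniformly on the projective line, so
    composing with a homography on either side is a linear combination or a linear substitution. *)
Lemma RatMapsP f : RatMaps f <-> exists n F G, [/\ isform n F, isform n G,
  forall x y, nz x y -> nz (F x y) (G x y) &
  forall x y, nz x y -> f (proj x y) = proj (F x y) (G x y)].
Proof.
split=> [[p [q [cpq ->]]]|[n [F [G [[p [sp pF pF0]] [q [sq qG qG0]] nFG fE]]]]].
  pose n := (maxn (size p) (size q)).-1.
  (* Coprimality excludes [p = q = 0], so the predecessor in [n] truncates nothing. *)
  have n1 : n.+1 = maxn (size p) (size q).
    rewrite prednK // leq_max !size_poly_gt0.
    case: eqP cpq => //= ->; case: eqP => //= ->.
    by rewrite coprimep_def gcdp0 size_poly0.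
  have sp : (size p <= n.+1)%N by rewrite n1 leq_maxl.
  have sq : (size q <= n.+1)%N by rewrite n1 leq_maxr.
  pose H (r : {poly R[i]}) x y := if y == 0 then r`_n * x ^+ n else y ^+ n * r.[x / y].
  have HF (r : {poly R[i]}) : (size r <= n.+1)%N -> isform n (H r).
    by move=> sr; exists r; split=> // [x y /negPf|x]; rewrite /H ?eqxx // => ->.
  exists n, (H p), (H q); split; [exact: HF|exact: HF| |].
    move=> x y; rewrite /nz /H; case: (eqVneq y 0) => [_|y0 _].
      rewrite orbF => x0; rewrite !mulf_eq0 (negPf (expf_neq0 _ x0)) !orbF.
      case: (leqP (size p) (size q)) => pq.
        have -> : n = (size q).-1 by rewrite /n (maxn_idPr pq).
        have q0 : q != 0 by rewrite -size_poly_gt0; move: n1; rewrite (maxn_idPr pq) => <-.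
        by rewrite -lead_coefE lead_coef_eq0 q0 orbT.
      have -> : n = (size p).-1 by rewrite /n (maxn_idPl (ltnW pq)).
      have p0 : p != 0 by rewrite -size_poly_gt0 (leq_trans _ pq).
      by rewrite -lead_coefE lead_coef_eq0 p0.
    rewrite !mulf_eq0 (negPf (expf_neq0 _ y0)) /=.
    case: eqP => //= /eqP p0; apply: coprimep_root cpq _; exact: p0.
  move=> x y; rewrite /nz /H /proj; case: (eqVneq y 0) => [_|y0 _] /=.
    rewrite orbF => x0; rewrite mulf_eq0 (negPf (expf_neq0 _ x0)) orbF.
    rewrite -mulf_div divff ?expf_neq0 // mulr1.
    case: ltnP => pq.
      have -> : n = (size p).-1 by rewrite /n (maxn_idPl (ltnW pq)).
      by rewrite [q`_ _]nth_default ?eqxx // -ltnS prednK // (leq_trans _ pq).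
    have -> : n = (size q).-1 by rewrite /n (maxn_idPr pq).
    have q0 : q != 0 by rewrite -size_poly_gt0; move: n1; rewrite (maxn_idPr pq) => <-.
    by rewrite -lead_coefE lead_coef_eq0 (negPf q0).
  rewrite mulf_eq0 (negPf (expf_neq0 _ y0)) /=; case: eqP => // _.
  by congr Some; rewrite -mulf_div divff ?expf_neq0 ?mul1r.
exists p, q; split.
  apply/Pdiv.ClosedField.coprimepP => x p0.
  have := nFG x 1; rewrite /nz oner_eq0 orbT pF ?oner_eq0 // qG ?oner_eq0 //.
  by rewrite expr1n !mul1r divr1 (eqP p0) eqxx; apply.
apply/funext => -[z|].
  rewrite projE fE; last by rewrite /nz oner_eq0 orbT.
  rewrite pF ?oner_eq0 // qG ?oner_eq0 // expr1n !mul1r -projE /=.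
  by rewrite divr1.
rewrite projoo fE; last by rewrite /nz oner_eq0.
rewrite pF0 qG0 expr1n !mulr1 -projoo /= /proj.
have := nFG 1 0; rewrite /nz oner_eq0 pF0 qG0 expr1n !mulr1 => /(_ isT) pqn.
have nth0 (r : {poly R[i]}) : (size r <= n.+1)%N -> r`_n != 0 -> size r = n.+1.
  move=> sr; apply: contraNeq => sr'; rewrite nth_default //.
  by rewrite -ltnS ltn_neqAle sr' sr.
case: (eqVneq q`_n 0) pqn => [q0|q0 _].
  rewrite orbF => /(nth0 _ sp) spn; rewrite spn /=.
  have : size q != n.+1.
    apply/eqP => sqn; move: q0; apply/eqP.
    have -> : n = (size q).-1 by rewrite sqn.
    by rewrite -lead_coefE lead_coef_eq0 -size_poly_gt0 sqn.
  by rewrite ltn_neqAle => -> ; rewrite sq.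
by rewrite lead_coefE (nth0 _ sq q0) ltnNge sp /=.
Qed.

Lemma RatMaps_mobl f g : isMob f -> RatMaps g -> RatMaps (f \o g).
Proof.
move=> [a [b [c [d [D ->]]]]] /RatMapsP[n [F [G [hF hG nFG gE]]]].
apply/RatMapsP; exists n, (fun x y => a * F x y + b * G x y), (fun x y => c * F x y + d * G x y).
split; [by apply: isformD; exact: isformZ|by apply: isformD; exact: isformZ| |].
- by move=> x y n0; apply: nz_mob => //; exact: nFG.
- by move=> x y n0 /=; rewrite gE // mob_proj //; exact: nFG.
Qed.

Lemma RatMaps_mobr f g : isMob f -> RatMaps g -> RatMaps (g \o f).
Proof.
move=> [a [b [c [d [D ->]]]]] /RatMapsP[n [F [G [hF hG nFG gE]]]].
apply/RatMapsP; exists n, (fun x y => F (a * x + b * y) (c * x + d * y)),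
  (fun x y => G (a * x + b * y) (c * x + d * y)).
split; [exact: isform_subst|exact: isform_subst| |].
- by move=> x y n0; apply: nFG; exact: nz_mob.
- by move=> x y n0 /=; rewrite mob_proj // gE //; exact: nz_mob.
Qed.

Lemma RatMaps_id : RatMaps (@id (sphere R)).
Proof.
apply/RatMapsP; exists 1%N, (fun x y => 1 * x + 0 * y), (fun x y => 0 * x + 1 * y).
by split; [exact: isform_lin|exact: isform_lin| |];
  move=> x y n0; rewrite !mul0r !mul1r addr0 add0r.
Qed.

Lemma RatMaps_mob f : isMob f -> RatMaps f.
Proof. move=> mf; exact: RatMaps_mobl mf RatMaps_id. Qed.

Lemma RatMaps_cst s : RatMaps (cst s : sphere R -> sphere R).
Proof.
have [a [b [n ->]]] := proj_surj s; apply/RatMapsP.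
exists 0%N, (fun=> fun=> a), (fun=> fun=> b); split=> //; exact: isform_cst.
Qed.

Lemma RatMaps_conj f : RatMaps f -> RatMaps (@conj_sphere R \o f \o @conj_sphere R).
Proof.
move=> [p [q [cpq ->]]]; exists (map_poly conjc p), (map_poly conjc q).
rewrite coprimep_map; split=> //; apply/funext => -[z|] /=.
  have hE (r : {poly R[i]}) : (map_poly conjc r).[z] = conjc r.[z^*%C].
    by rewrite -[z in LHS]conjcK horner_map.
  rewrite !hE fmorph_eq0; case: eqP => //= _.
  by rewrite -fmorph_div.
rewrite !size_map_poly; case: ltnP => // _ /=.
by rewrite fmorph_div lead_coef_map coef_map.
Qed.

(** By injectivity infinity is the only pole and 0 the only zero, so over an algebraically closed
    field the map is a monomial [c z^m]; injectivity once more leaves [m = 1]. *)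
Lemma RatMaps_inj_normal f : RatMaps f -> injective f -> f (Some 0) = Some 0 -> f None = None ->
  exists2 c, c != 0 & f = mob c 0 0 1.
Proof.
move=> [p [q [cpq ->]]] finj f0 foo.
have qN0 z : q.[z] != 0.
  apply/eqP => q0; have /finj // : ratmap p q (Some z) = ratmap p q None.
  by rewrite foo /= q0 eqxx.
have sq : size q = 1%N.
  by apply/eqP; apply/negPn/negP => /closed_rootP[x]; rewrite /root (negPf (qN0 x)).
have /size_poly1P[k k0 qk] : size q == 1%N by rewrite sq.
have fE z : ratmap p q (Some z) = Some (p.[z] / k) by rewrite /= qk hornerC (negPf k0).
have p00 : p.[0] = 0.
  by move: f0; rewrite fE => -[/eqP]; rewrite mulf_eq0 invr_eq0 (negPf k0) orbF => /eqP.
have pN0 z : p.[z] = 0 -> z = 0.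
  by move=> pz; have [] // : Some z = Some 0 :> sphere R; apply: finj; rewrite !fE p00 pz.
have [m [p1]] := multiplicity_XsubC p 0.
have p0 : p != 0.
  apply/eqP => p0; have := pN0 1; rewrite p0 horner0 => /(_ erefl)/eqP.
  by rewrite oner_eq0.
rewrite p0 /= subr0 => p1r pE.
have sp1 : size p1 = 1%N.
  apply/eqP; apply/negPn/negP => /closed_rootP[x p1x].
  have x0 : x = 0 by apply: pN0; rewrite pE hornerM (eqP p1x) mul0r.
  by move: p1r; rewrite -x0 p1x.
have /size_poly1P[l l0 p1l] : size p1 == 1%N by rewrite sp1.
have {}fE z : ratmap p q (Some z) = Some (l / k * z ^+ m).
  by rewrite fE pE p1l hornerM hornerC hornerXn mulrAC.
have m1 : m = 1%N.
  case: m {pE} fE => [|[|m]] // fE.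
    by have [/eqP] : Some 0 = Some 1 :> sphere R;
      [apply: finj; rewrite !fE|rewrite eq_sym oner_eq0].
  (* The exponent is now [m.+2]. A root of [1 + X + ... + X^(m+1)] is a root of unity with the same
     image as 1, hence equals 1; but the value of [r] at 1 is [m + 2]. *)
  pose r : {poly R[i]} := \poly_(i < m.+2) 1.
  have rE z : r.[z] = \sum_(i < m.+2) z ^+ i.
    by rewrite horner_poly; apply: eq_bigr => i _; rewrite mul1r.
  have /closed_rootP[z /eqP] : size r != 1%N by rewrite size_poly_eq ?oner_neq0.
  rewrite rE => rz.
  have z1 : z = 1.
    have [] // : Some z = Some 1 :> sphere R.
    apply: finj; rewrite !fE expr1n; congr Some; congr (_ * _); apply/eqP.
    by rewrite -subr_eq0 subrX1 rz mulr0.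
  move: rz; rewrite z1; under eq_bigr do rewrite expr1n.
  by rewrite sumr_const card_ord => /eqP; rewrite pnatr_eq0.
exists (l / k); first by rewrite mulf_neq0 ?invr_eq0.
apply/funext => -[z|].
  by rewrite fE m1 expr1 mob_affine addr0.
by rewrite foo mob_affineoo.
Qed.

Lemma RatMaps_inj_mob f : RatMaps f -> injective f -> isMob f.
Proof.
move=> rf fi.
have /mob_to0oo[g [mg g0 goo]] : f (Some 0) != f None by apply/eqP => /fi.
have [c c0 gfE] : exists2 c, c != 0 & g \o f = mob c 0 0 1.
  apply: RatMaps_inj_normal => //; first exact: RatMaps_mobl.
  by apply: inj_comp => //; exact: isMob_inj.
have [h [mh gh hg]] := isMob_inv mg.
have -> : f = h \o mob c 0 0 1 by rewrite -gfE; apply/funext => s /=; rewrite gh.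
by apply: isMob_comp => //; exact: isMob_affine.
Qed.

(** A homography moves the target to infinity, so it suffices to find a pole: a denominator without
    root is constant, and then infinity is a pole unless the numerator is constant too. *)
Lemma RatMaps_surj f : RatMaps f -> nonconstant f -> forall s, exists t, f t = s.
Proof.
move=> rf nf s.
suff oo g : RatMaps g -> nonconstant g -> exists t, g t = None.
  have [s' /mob_to0oo[g [mg g0 goo]]] : exists s', s' != s.
    by case: s => [z|]; [exists None|exists (Some 0)].
  have gi := isMob_inj mg.
  have [||t gt] := oo (g \o f); [exact: RatMaps_mobl| |].
    move=> [c gc]; apply: nf; exists (f None); apply/funext => t; apply: gi.
    by have := congr1 (@^~ t) gc; rewrite /= => ->; have := congr1 (@^~ None) gc.
  by exists t; apply: gi; rewrite goo.
move=> [p [q [cpq ->]]] ng.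
have [/closed_rootP[z qz]|/negPn/size_poly1P[k k0 qk]] := boolP (size q != 1%N).
  by exists (Some z); rewrite /= (eqP qz) eqxx.
exists None; rewrite /= {1}qk size_polyC k0; case: ltnP => // sp; exfalso; apply: ng.
rewrite (size1_polyC sp); exists (Some (p`_0 / k)); apply/funext => -[z|] /=.
  by rewrite qk !hornerC (negPf k0).
rewrite qk size_polyC k0 lead_coefC ltnNge /= (size_polyC_leq1 _) /=.
by rewrite coefC.
Qed.

End Rational.

(** * Goursat's theorem *)

Section RealGoursat.
Variable R : realType.
Implicit Types (a b c d x y e : R).

(** The primitive is valid only to the right of its base point, which is why the rectangles below
    stay in a quadrant beyond [L]. *)
Lemma continuous_primitive (u : R -> R) a : continuous u ->
  exists U : R -> R, forall x, a < x -> is_derive x 1 U (u x).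
Proof.
move=> cu; exists (fun x => \int[lebesgue_measure]_(t in [set` `[a, x]]) u t)%R.
move=> x ax; have xx1 : x < x + 1 by rewrite ltrDl.
have [||dF FE] := @continuous_FTC1_closed R u a x _ xx1 _ ax.
- apply: continuous_compact_integrable; first exact: segment_compact.
  exact: continuous_subspaceT.
- exact: cu.
- by rewrite -FE derive1E; exact: DeriveDef.
Qed.

(** Takes the place of an integral estimate: integrals occur only as increments of primitives,
    compared here with the increment of an explicit model [g]. *)
Lemma mvt_diff (f g f' g' : R -> R) k a b : a <= b ->
  (forall x, a <= x <= b -> is_derive x 1 f (f' x)) ->
  (forall x, a <= x <= b -> is_derive x 1 g (g' x)) ->
  (forall x, a <= x <= b -> `|f' x - g' x| <= k) ->
  `|(f b - f a) - (g b - g a)| <= k * (b - a).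
Proof.
move=> ab df dg fg.
pose h x := f x - g x.
have dh x : a <= x <= b -> is_derive x 1 h (f' x - g' x).
  by move=> xab; apply: is_deriveB; [exact: df|exact: dg].
have [||c cab fgE] := @MVT_segment R h (fun x => f' x - g' x) a b ab.
- by move=> x; rewrite in_itv /= => /andP[ax xb]; apply: dh; rewrite !ltW.
- by apply: derivable_within_continuous => x; rewrite in_itv /= => /dh[].
have -> : (f b - f a) - (g b - g a) = h b - h a by rewrite /h; ring.
rewrite fgE normrM (ger0_norm (x := b - a)) ?subr_ge0 // ler_wpM2r ?subr_ge0 //.
by apply: fg; move: cab; rewrite in_itv.
Qed.

Lemma is_derive_quad k0 k1 k2 x0 x :
  is_derive x 1 (fun t : R => k0 + k1 * (t - x0) + k2 * (t - x0) ^+ 2)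
    (k1 + 2 * k2 * (x - x0)).
Proof.
have -> : (fun t : R => k0 + k1 * (t - x0) + k2 * (t - x0) ^+ 2) =
  (cst k0 + k1 \*: (id - cst x0) + k2 \*: ((id - cst x0) ^+ 2)) by [].
apply: is_derive_eq.
change (0 + k1 * (1 - 0) + k2 * (2 * (x - x0) ^+ 1 * (1 - 0)) = k1 + 2 * k2 * (x - x0)).
by ring.
Qed.

(* [P dx + Q dy] is differentiable and closed at [(x0, y0)]. *)
Definition closed_form_at (P Q : R -> R -> R) x0 y0 := exists al be ga,
  forall e, 0 < e -> exists2 dl, 0 < dl &
    forall x y, `|x - x0| <= dl -> `|y - y0| <= dl ->
    `|P x y - (P x0 y0 + al * (x - x0) + be * (y - y0))| <= e * (`|x - x0| + `|y - y0|) /\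
    `|Q x y - (Q x0 y0 + be * (x - x0) + ga * (y - y0))| <= e * (`|x - x0| + `|y - y0|).

Section Rectangle.
Variables (P Q X Y : R -> R -> R) (L : R).
Hypothesis closedPQ : forall x y, closed_form_at P Q x y.
Hypothesis dX : forall x y, L < x -> is_derive x 1 (X y) (P x y).
Hypothesis dY : forall x y, L < y -> is_derive y 1 (Y x) (Q x y).

(* As [X y] and [Y x] are primitives of [P^~ y] and [Q x], this is the integral
   of [P dx + Q dy] along the boundary of [[a, b] x [c, d]]. *)
Definition circulation a b c d :=
  (X c b - X c a) + (Y b d - Y b c) - (X d b - X d a) - (Y a d - Y a c).

Lemma circulation_small x0 y0 e : 0 < e -> exists2 dl, 0 < dl &
  forall a b c d, L < a -> L < c -> a <= x0 <= b -> c <= y0 <= d ->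
  (b - a) + (d - c) <= dl ->
  `|circulation a b c d| <= 2 * e * ((b - a) + (d - c)) ^+ 2.
Proof.
move=> e0; have [al [be [ga /(_ e e0)[dl dl0 PQ]]]] := closedPQ x0 y0.
exists dl => // a b c d La Lc /andP[ax0 x0b] /andP[cy0 y0d] s_dl.
set s := (b - a) + (d - c).
(* A potential of the affine part of the form at [(x0, y0)]; it exists because [be] is shared by [P]
   and [Q]. Its circulation vanishes, and what remains is at most [e * s] times the perimeter
   [2 * s]. *)
pose Phi x y := P x0 y0 * (x - x0) + Q x0 y0 * (y - y0) + al / 2 * (x - x0) ^+ 2 +
  be * (x - x0) * (y - y0) + ga / 2 * (y - y0) ^+ 2.
have PQs x y : a <= x <= b -> c <= y <= d ->
    `|P x y - (P x0 y0 + al * (x - x0) + be * (y - y0))| <= e * s /\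
    `|Q x y - (Q x0 y0 + be * (x - x0) + ga * (y - y0))| <= e * s.
  move=> /andP[ax xb] /andP[cy yd].
  have xx : `|x - x0| <= b - a by rewrite ler_norml; apply/andP; split; lra.
  have yy : `|y - y0| <= d - c by rewrite ler_norml; apply/andP; split; lra.
  have [||Pxy Qxy] := PQ x y; [by rewrite /s in s_dl *; lra..|].
  by split; [apply: le_trans Pxy _|apply: le_trans Qxy _];
    rewrite ler_wpM2l ?(ltW e0) // lerD.
have hX y : c <= y <= d ->
    `|(X y b - X y a) - (Phi b y - Phi a y)| <= e * s * (b - a).
  move=> ycd; apply: (@mvt_diff (X y) (Phi^~ y) (P^~ y)
    (fun x => P x0 y0 + al * (x - x0) + be * (y - y0))); first by lra.
  - by move=> x /andP[ax _]; apply: dX; exact: lt_le_trans ax.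
  - move=> x _; have -> : Phi^~ y = fun t : R =>
        (Q x0 y0 * (y - y0) + ga / 2 * (y - y0) ^+ 2) +
        (P x0 y0 + be * (y - y0)) * (t - x0) + al / 2 * (t - x0) ^+ 2.
      by apply/funext => t; rewrite /Phi; field.
    apply: (@is_derive_eq _ _ _ _ _ _ _ _ (is_derive_quad _ _ _ _ _)).
    by field.
  - by move=> x xab; have [] := PQs x y xab ycd.
have hY x : a <= x <= b ->
    `|(Y x d - Y x c) - (Phi x d - Phi x c)| <= e * s * (d - c).
  move=> xab; apply: (@mvt_diff (Y x) (Phi x) (Q x)
    (fun y => Q x0 y0 + be * (x - x0) + ga * (y - y0))); first by lra.
  - by move=> y /andP[cy _]; apply: dY; exact: lt_le_trans cy.
  - move=> y _; have -> : Phi x = fun t : R =>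
        (P x0 y0 * (x - x0) + al / 2 * (x - x0) ^+ 2) +
        (Q x0 y0 + be * (x - x0)) * (t - y0) + ga / 2 * (t - y0) ^+ 2.
      by apply/funext => t; rewrite /Phi; field.
    apply: (@is_derive_eq _ _ _ _ _ _ _ _ (is_derive_quad _ _ _ _ _)).
    by field.
  - by move=> y ycd; have [] := PQs x y xab ycd.
have hXc := hX c ltac:(apply/andP; split; lra).
have hXd := hX d ltac:(apply/andP; split; lra).
have hYa := hY a ltac:(apply/andP; split; lra).
have hYb := hY b ltac:(apply/andP; split; lra).
have -> : 2 * e * s ^+ 2 = e * s * (b - a) + e * s * (d - c) + e * s * (b - a) + e * s * (d - c).
  by rewrite /s; ring.
move: hXc hXd hYa hYb; rewrite !ler_norml /circulation.
set u1 := e * s * (b - a); set u2 := e * s * (d - c).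
move=> /andP[? ?] /andP[? ?] /andP[? ?] /andP[? ?]; apply/andP; split; lra.
Qed.

(** Only the lower left corner [q] is tracked, as the sides are always halved. A quarter is kept
    when it carries at least a fourth of the circulation. *)
Let quarter (w h : R) (q : R * R) : R * R :=
  let m := `|circulation q.1 (q.1 + w) q.2 (q.2 + h)| / 4 in
  let ok x y := m <= `|circulation x (x + w / 2) y (y + h / 2)| in
  if ok q.1 q.2 then q
  else if ok (q.1 + w / 2) q.2 then (q.1 + w / 2, q.2)
  else if ok q.1 (q.2 + h / 2) then (q.1, q.2 + h / 2)
  else (q.1 + w / 2, q.2 + h / 2).

Let quarterP w h q : 0 <= w -> 0 <= h ->
  let q' := quarter w h q in
  [/\ q.1 <= q'.1, q'.1 + w / 2 <= q.1 + w, q.2 <= q'.2, q'.2 + h / 2 <= q.2 + h &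
   `|circulation q.1 (q.1 + w) q.2 (q.2 + h)| / 4 <=
   `|circulation q'.1 (q'.1 + w / 2) q'.2 (q'.2 + h / 2)|].
Proof.
move=> w0 h0; rewrite /quarter.
case: ifPn => [h1|h1]; first by split=> //; lra.
case: ifPn => [h2|h2] /=; first by split=> //; lra.
case: ifPn => [h3|h3] /=; first by split=> //; lra.
(* The last quarter is chosen untested: circulation is additive, so if the other three fall short
   this one cannot. *)
split; try lra.
move: h1 h2 h3; rewrite -!ltNge; case: q => x y /=.
have -> : circulation x (x + w) y (y + h) =
    circulation x (x + w / 2) y (y + h / 2) +
    circulation (x + w / 2) (x + w / 2 + w / 2) y (y + h / 2) +
    circulation x (x + w / 2) (y + h / 2) (y + h / 2 + h / 2) +
    circulation (x + w / 2) (x + w / 2 + w / 2) (y + h / 2) (y + h / 2 + h / 2).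
  have -> : x + w = x + w / 2 + w / 2 by field.
  have -> : y + h = y + h / 2 + h / 2 by field.
  by rewrite /circulation; ring.
set c1 := circulation x _ y _; set c2 := circulation _ _ y _.
set c3 := circulation x _ _ _; set c4 := circulation _ _ _ _.
have := ler_normD (c1 + c2 + c3) c4; have := ler_normD (c1 + c2) c3.
have := ler_normD c1 c2; lra.
Qed.

(** After [n] bisections the circulation is at least [4^-n] times the initial one, while near the
    common point it is at most an arbitrarily small multiple of the squared side length, itself of
    order [4^-n]. *)
Lemma goursat a b c d : L < a -> L < c -> a <= b -> c <= d -> circulation a b c d = 0.
Proof.
move=> La Lc ab cd; pose W n : R := (b - a) / 2 ^+ n; pose H n : R := (d - c) / 2 ^+ n.
pose fix q n : R * R := if n is m.+1 then quarter (W m) (H m) (q m) else (a, c).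
have half (u : R) n : u / 2 ^+ n.+1 = u / 2 ^+ n / 2.
  by rewrite exprSr invfM mulrA.
have W0 n : 0 <= W n by rewrite divr_ge0 ?subr_ge0 ?exprn_ge0.
have H0 n : 0 <= H n by rewrite divr_ge0 ?subr_ge0 ?exprn_ge0.
have qP n := quarterP (q n) (W0 n) (H0 n).
have mono n m : (q n).1 <= (q (n + m)%N).1 /\ (q (n + m)%N).1 + W (n + m)%N <= (q n).1 + W n.
  elim: m => [|m [IH1 IH2]]; first by rewrite addn0.
  rewrite addnS; have [h1 h2 _ _ _] := qP (n + m)%N.
  by rewrite /W half -/(W _); split; [exact: le_trans h1|exact: le_trans IH2].
have mono' n m : (q n).2 <= (q (n + m)%N).2 /\ (q (n + m)%N).2 + H (n + m)%N <= (q n).2 + H n.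
  elim: m => [|m [IH1 IH2]]; first by rewrite addn0.
  rewrite addnS; have [_ _ h1 h2 _] := qP (n + m)%N.
  by rewrite /H half -/(H _); split; [exact: le_trans h1|exact: le_trans IH2].
have big n : `|circulation a b c d| / 4 ^+ n <=
    `|circulation (q n).1 ((q n).1 + W n) (q n).2 ((q n).2 + H n)|.
  elim: n => [|n IH].
    by rewrite expr0 divr1 /= /W /H !expr0 !divr1 !subrKC.
  have [_ _ _ _] := qP n; rewrite -/(q n.+1) -!half => h.
  apply: le_trans h; rewrite exprSr invfM mulrA.
  by rewrite ler_pM2r.
have ubd n m : (q n).1 <= (q m).1 + W m.
  case: (leqP m n) => [/subnKC <-|/ltnW /subnKC <-].
    have [_ h] := mono m (n - m)%N; apply: le_trans h.
    by rewrite lerDl.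
  have [h _] := mono n (m - n)%N; apply: le_trans h _.
  by rewrite lerDl.
have ubd' n m : (q n).2 <= (q m).2 + H m.
  case: (leqP m n) => [/subnKC <-|/ltnW /subnKC <-].
    have [_ h] := mono' m (n - m)%N; apply: le_trans h.
    by rewrite lerDl.
  have [h _] := mono' n (m - n)%N; apply: le_trans h _.
  by rewrite lerDl.
(* Nested intervals, with the supremum of the left ends as common point. *)
have nested (r : nat -> R) (w : nat -> R) : (forall n m, r n <= r m + w m) ->
    exists x0, forall n, r n <= x0 <= r n + w n.
  move=> rw; exists (sup (range r)) => n; apply/andP; split.
    by apply: ub_le_sup; [exists (r n + w n) => _ [m _ <-]|exists n].
  by apply: ge_sup; [exists (r 0%N), 0%N|move=> _ [m _ <-]].
have [x0 x0P] := nested _ _ ubd; have [y0 y0P] := nested _ _ ubd'.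
apply/normr0_eq0/le_anti/andP; split => //.
apply/ler_addgt0Pr => e e0; rewrite add0r.
(* The [+ 1] keeps [s] positive for degenerate rectangles. The tolerance [e / (2 * s ^+ 2)] makes
   the final bound [e] after multiplication by [4^n]. *)
pose s := b - a + (d - c) + 1.
have s0 : 0 < s by rewrite /s; lra.
have [dl dl0 small] := @circulation_small x0 y0 (e / (2 * s ^+ 2))
  ltac:(by rewrite divr_gt0 // mulr_gt0 // exprn_gt0).
have [n nP] : exists n : nat, s / 2 ^+ n <= dl.
  have [n] := near_infty_natSinv_expn_lt (PosNum (divr_gt0 dl0 s0)).
  move=> _ /(_ n (leqnn n)) /=; rewrite div1r => h; exists n.
  by rewrite mulrC -ler_pdivlMr // ltW.
have WH : W n + H n <= s / 2 ^+ n.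
  by rewrite /W /H -mulrDl ler_wpM2r // /s; lra.
have := small (q n).1 ((q n).1 + W n) (q n).2 ((q n).2 + H n).
have [/= an _] := mono 0%N n; have [/= cn _] := mono' 0%N n.
have -> : (q n).1 + W n - (q n).1 + ((q n).2 + H n - (q n).2) = W n + H n by ring.
move=> /(_ (lt_le_trans La an) (lt_le_trans Lc cn) (x0P n) (y0P n) (le_trans WH nP)).
move=> /(le_trans (big n)); rewrite ler_pdivrMr ?exprn_gt0 // => /le_trans; apply.
have -> : 2 * (e / (2 * s ^+ 2)) * (W n + H n) ^+ 2 * 4 ^+ n =
    e * ((W n + H n) / (s / 2 ^+ n)) ^+ 2.
  have -> : 4 = 2 ^+ 2 :> R by ring.
  rewrite exprAC; field.
  by rewrite (gt_eqF s0) expf_neq0.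
have s2 : 0 < s / 2 ^+ n by rewrite divr_gt0 // exprn_gt0.
have WH0 : 0 <= (W n + H n) / (s / 2 ^+ n) by rewrite divr_ge0 ?(ltW s2) // addr_ge0.
by rewrite ler_piMr ?(ltW e0) // expr_le1 // ler_pdivrMr ?mul1r.
Qed.

End Rectangle.

Lemma closed_form_at_horizontal_continuous P Q x0 y0 : closed_form_at P Q x0 y0 ->
  {for x0, continuous (P^~ y0)}.
Proof.
move=> [al [be [ga PQ]]]; apply/cvgrPdist_le => e e0.
have [dl dl0 {}PQ] := PQ 1 ltr01.
have k0 : 0 < 1 + `|al| by rewrite ltr_pwDl.
near=> x.
have xx : `|x - x0| <= Num.min dl (e / (1 + `|al|)).
  rewrite distrC; near: x; apply: cvgr_dist_le; first exact: cvg_id.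
  by rewrite lt_min dl0 divr_gt0.
have [||h _] := PQ x y0.
- by apply: le_trans xx _; rewrite ge_min lexx.
- by rewrite subrr normr0 ltW.
rewrite distrC.
have -> : P x y0 - P x0 y0 = (P x y0 - (P x0 y0 + al * (x - x0) + be * (y0 - y0))) + al * (x - x0).
  by ring.
apply: le_trans (ler_normD _ _) _; apply: le_trans (lerD h (lexx _)) _.
rewrite subrr normr0 addr0 normrM -mulrDl mulrC -ler_pdivlMr //.
by apply: le_trans xx _; rewrite ge_min lexx orbT.
Unshelve. all: by end_near. Qed.

Lemma closed_form_atC P Q x0 y0 : closed_form_at P Q x0 y0 ->
  closed_form_at (fun y x => Q x y) (fun y x => P x y) y0 x0.
Proof.
move=> [al [be [ga PQ]]]; exists ga, be, al => e /PQ[dl dl0 {}PQ].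
exists dl => // y x yy xx; have [hP hQ] := PQ x y xx yy.
by rewrite ![_ + _ + be * _]addrAC [`|y - y0| + _]addrC; split; rewrite // addrAC.
Qed.

(** Periodicity makes the horizontal sides cancel, so the vertical sides carry equal integrals; far
    out these are close to [q * T] and [q' * T]. *)
Lemma periodic_closed_form_limits (P Q : R -> R -> R) (T q q' : R) : 0 < T ->
  (forall x y, closed_form_at P Q x y) ->
  (forall x, P x T = P x 0) ->
  (forall e, 0 < e -> exists M, forall x y, M <= x -> `|Q x y - q| <= e) ->
  (forall e, 0 < e -> exists M, forall x y, x <= M -> `|Q x y - q'| <= e) ->
  q = q'.
Proof.
move=> T0 PQ PT Qq Qq'; apply/eqP; rewrite -subr_eq0 -normr_le0.
apply/ler_addgt0Pr => e e0; rewrite add0r.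
have [M MP] := Qq (e / 2) ltac:(by rewrite divr_gt0).
have [M' M'P] := Qq' (e / 2) ltac:(by rewrite divr_gt0).
(* [a <= 0 <= b] orders the vertical sides, and [L < 0] makes the primitives in [y] valid from the
   bottom side [y = 0] on. *)
pose b := Num.max M 0; pose a := Num.min M' 0; pose L := a - 1.
have a0 : a <= 0 by rewrite /a ge_min lexx orbT.
have b0 : 0 <= b by rewrite /b le_max lexx orbT.
have La : L < a by rewrite /L; lra.
have L0 : L < 0 by lra.
(* One primitive is chosen per function, not per height: [P^~ T] and [P^~ 0] are the same function,
   so their sides cancel literally. Functions that are not continuous get a dummy value. *)
have /choice[X dX] : forall u : R -> R, exists U : R -> R, continuous u ->
    forall x, L < x -> is_derive x 1 U (u x).
  move=> u; have [cu|ncu] := pselect (continuous u).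
    by have [U dU] := continuous_primitive L cu; exists U.
  by exists u => /ncu.
have dP x y : L < x -> is_derive x 1 (X (P^~ y)) (P x y).
  by apply: dX => {}x; exact: closed_form_at_horizontal_continuous (PQ x y).
have dQ x y : L < y -> is_derive y 1 (X (Q x)) (Q x y).
  apply: dX => {}y; apply: (@closed_form_at_horizontal_continuous (fun y x => Q x y) (fun y x => P x y)).
  exact: closed_form_atC.
have := @goursat P Q (fun y => X (P^~ y)) (fun x => X (Q x)) L PQ dP dQ a b 0 T La L0
  (le_trans a0 b0) (ltW T0).
rewrite /circulation (_ : P^~ T = P^~ 0); last by apply/funext => x; rewrite PT.
set u := X _ b - X _ a => circ0.
have side x r : (forall y, `|Q x y - r| <= e / 2) ->
    `|(X (Q x) T - X (Q x) 0) - (r * T - r * 0)| <= e / 2 * (T - 0).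
  move=> Qr; apply: (@mvt_diff (X (Q x)) (fun y => r * y) (Q x) (fun=> r)) => //; first exact: ltW.
    by move=> y /andP[y0 _]; apply: dQ; exact: lt_le_trans y0.
  move=> y _; have -> : (fun y => r * y) = r \*: id by [].
  by apply: is_derive_eq; rewrite [_ *: _]mulr1.
have hb := side b q ltac:(by move=> y; apply: MP; rewrite /b le_max lexx).
have ha := side a q' ltac:(by move=> y; apply: M'P; rewrite /a ge_min lexx).
rewrite -(ler_pM2r T0) -{1}(gtr0_norm T0) -normrM.
move: ha hb; rewrite !ler_norml => /andP[? ?] /andP[? ?]; apply/andP; split; lra.
Qed.

End RealGoursat.

(** * Entire functions of linear growth *)

Section Complex.
Variable R : realType.
Local Notation C := R[i]^o.
Implicit Types (z w d : R[i]) (e : R).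
Local Notation normc := (@Normc.normc R).
Local Notation Re := (@complex.Re R).
Local Notation Im := (@complex.Im R).

Lemma normcE z : `|z| = (normc z)%:C.
Proof. by []. Qed.

Lemma normc_ge0 z : 0 <= normc z.
Proof. by case: z => x y; rewrite sqrtr_ge0. Qed.

Lemma normcD z w : normc (z + w) <= normc z + normc w.
Proof. exact: le_normcD. Qed.

Lemma normcB z w : normc (z - w) = normc (w - z).
Proof. by rewrite -normcN opprB. Qed.

Lemma normc_eq0 z : (normc z == 0) = (z == 0).
Proof. by apply/eqP/eqP => [/Normc.eq0_normc|->] //; rewrite Normc.normc0. Qed.

Lemma normc_gt0 z : (0 < normc z) = (z != 0).
Proof. by rewrite lt_def normc_eq0 normc_ge0 andbT. Qed.

Lemma normc_real (x : R) : normc x%:C = `|x|.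
Proof. by rewrite /= expr0n addr0 sqrtr_sqr. Qed.

Lemma normc_Re z : `|Re z| <= normc z.
Proof. by rewrite -lecR; exact: normc_ge_Re. Qed.

Lemma normc_Im z : `|Im z| <= normc z.
Proof.
case: z => x y /=; rewrite -sqrtr_sqr ler_sqrt; first by rewrite lerDr sqr_ge0.
by rewrite addr_ge0 ?sqr_ge0.
Qed.

Lemma normc_le z : normc z <= `|Re z| + `|Im z|.
Proof.
rewrite (complexE z) (le_trans (normcD _ _)) // Normc.normcM !normc_real.
rewrite /= expr0n expr1n add0r sqrtr1 mul1r /=.
by rewrite !(mul0r, mulr0, mul1r, mulr1, subr0, addr0, add0r).
Qed.

(** The norm of [R[i]] has values in [R[i]], so balls have complex radii; a positive one has zero
    imaginary part, and real radii suffice. *)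
Lemma nbhsCP (z : C) (A : set C) :
  nbhs z A <-> exists2 dl : R, 0 < dl & forall w, normc (w - z) < dl -> A w.
Proof.
split.
  move=> /nbhs_ballP[[e e'] /= e0 sub]; move: (e0); rewrite /= ltcE /= => /andP[/eqP e'0 er].
  rewrite e'0 in sub; exists e => // w wz; apply: sub.
  by rewrite /ball /= distrC normcE -[_ +i* _]/(e%:C) ltcR.
move=> [dl dl0 sub]; apply/nbhs_ballP; exists dl%:C => /=; first by rewrite ltcR.
by move=> w; rewrite /ball /= distrC normcE ltcR; exact: sub.
Qed.

Lemma continuousCP (f : C -> C) (z : C) : {for z, continuous f} <->
  forall e, 0 < e -> exists2 dl : R, 0 < dl & forall w, normc (w - z) < dl -> normc (f w - f z) < e.
Proof.
split=> [cf e e0|cf A].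
  have : nbhs (f z) [set w : C | normc (w - f z) < e] by apply/nbhsCP; exists e.
  by move=> /cf /nbhsCP.
move=> /nbhsCP[e e0 sub]; have [dl dl0 h] := cf e e0.
by apply/nbhsCP; exists dl => // w /h /sub.
Qed.
End Complex.

(** * Differentiability through continuous slopes *)

Section Caratheodory.
Variable K : numFieldType.
Implicit Types (f g : K^o -> K^o) (z d : K^o).

Lemma for_cst z d : {for z, continuous (fun=> d)}.
Proof. exact: cst_continuous. Qed.

Lemma for_id z : {for z, continuous (fun w : K^o => w)}.
Proof. exact: cvg_id. Qed.

Lemma for_D f g z : {for z, continuous f} -> {for z, continuous g} ->
  {for z, continuous (fun w => f w + g w)}.
Proof. exact: continuousD. Qed.

Lemma for_B f g z : {for z, continuous f} -> {for z, continuous g} ->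
  {for z, continuous (fun w => f w - g w)}.
Proof. exact: continuousB. Qed.

Lemma for_M f g z : {for z, continuous f} -> {for z, continuous g} ->
  {for z, continuous (fun w => f w * g w)}.
Proof. exact: continuousM. Qed.

Lemma for_V f z : f z != 0 -> {for z, continuous f} ->
  {for z, continuous (fun w => (f w)^-1)}.
Proof. by move=> fz cf; apply: continuousV. Qed.

Lemma for_comp f g z : {for z, continuous g} -> {for g z, continuous f} ->
  {for z, continuous (fun w => f (g w))}.
Proof. exact: continuous_comp. Qed.

(** With Carathéodory's slope [phi], continuous at [z], chain and quotient rules become algebraic
    identities between slopes, over the reals and the complex numbers alike. *)
Lemma caratheodory f z d : is_derive z 1 f d ->
  exists phi : K^o -> K^o, [/\ {for z, continuous phi}, phi z = d &
    forall w, f w = f z + phi w * (w - z)].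
Proof.
move=> df; pose phi w := if w == z then d else (f w - f z) / (w - z).
exists phi; split; last first.
- move=> w; rewrite /phi; case: eqP => [->|/eqP wz]; first by rewrite subrr mulr0 addr0.
  by rewrite divfK ?subrKC // subr_eq0.
- by rewrite /phi eqxx.
apply/continuous_withinNshiftx; rewrite {2}/phi eqxx.
have [cvgf <-] := df.
apply: cvg_trans cvgf; apply: near_eq_cvg; near=> h.
have h0 : h != 0 by near: h; exact: nbhs_dnbhs_neq.
rewrite /phi /= -subr_eq0 addrK (negPf h0) /GRing.scale /= mulr1.
by rewrite mulrC.
Unshelve. all: by end_near. Qed.

Lemma near_caratheodory f z (phi : K^o -> K^o) : {for z, continuous phi} ->
  (\forall w \near z, f w = f z + phi w * (w - z)) -> is_derive z 1 f (phi z).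
Proof.
move=> cphi fE.
have {}fE : \forall h \near (0 : K^o), f (h + z) = f z + phi (h + z) * h.
  move: fE; rewrite (near_shift (0 : K^o)); apply: filterS => h /=.
  by rewrite subr0 addrK.
have cvgf : h^-1 *: ((f \o shift z) (h *: 1) - f z) @[h --> 0^'] --> phi z.
  apply: cvg_trans (proj2 (continuous_withinNshiftx phi z) cphi).
  apply: near_eq_cvg; near=> h.
  have h0 : h != 0 by near: h; exact: nbhs_dnbhs_neq.
  rewrite /= [h *: 1]mulr1.
  have -> : f (h + z) = f z + phi (h + z) * h by near: h; exact: nbhs_dnbhs.
  by rewrite [f z + _]addrC addrK /GRing.scale /= mulrCA mulVf ?mulr1.
by apply: DeriveDef; [exact: cvgP cvgf|exact: cvg_lim cvgf].
Unshelve. all: by end_near. Qed.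

Lemma caratheodory_is_derive f z (phi : K^o -> K^o) : {for z, continuous phi} ->
  (forall w, f w = f z + phi w * (w - z)) -> is_derive z 1 f (phi z).
Proof.
move=> cphi fE; apply: (near_caratheodory cphi); near=> w; exact: fE.
Unshelve. all: by end_near. Qed.

Lemma is_derive_continuous f z d : is_derive z 1 f d -> {for z, continuous f}.
Proof. by move=> [df _]; apply: differentiable_continuous; exact/derivable1_diffP. Qed.

End Caratheodory.

(** * The complex exponential and a Liouville theorem *)

Section Liouville.
Variable R : realType.
Local Notation C := R[i]^o.
Implicit Types (z w d : R[i]) (e : R).
Local Notation normc := (@Normc.normc R).
Local Notation Re := (@complex.Re R).
Local Notation Im := (@complex.Im R).

Lemma is_derive_small (f : R -> R) (x d e : R) : is_derive x 1 f d -> 0 < e ->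
  exists2 dl, 0 < dl & forall h, `|h| < dl -> `|f (x + h) - f x - d * h| <= e * `|h|.
Proof.
move=> /(@caratheodory R)[phi [cphi phix fE]] e0.
have /cvgrPdist_le/(_ _ e0)/nbhs_ballP[dl /= dl0 sub] := cphi.
exists dl => // h hdl; have := sub (x + h).
rewrite /ball /= opprD addNKr normrN => /(_ hdl); rewrite phix distrC => hphi.
have -> : f (x + h) - f x - d * h = (phi (x + h) - d) * h by rewrite fE; ring.
by rewrite normrM ler_wpM2r.
Qed.

Lemma cisD (s t : R) : cis (s + t) = cis s * cis t.
Proof. by rewrite /cis cosD sinD; apply/eqP; rewrite eq_complex /= eqxx addrC mulrC [X in _ + X]mulrC eqxx. Qed.

Lemma normc_cis (t : R) : normc (cis t) = 1.
Proof. by rewrite /= cos2Dsin2 sqrtr1. Qed.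

Lemma cis2pi : cis (2 * pi) = 1 :> R[i].
Proof. by rewrite /cis mulr_natl cos2pi sin2pi. Qed.

Definition cexp z : R[i] := (expR (Re z))%:C * cis (Im z).

Lemma cexpD z w : cexp (z + w) = cexp z * cexp w.
Proof.
rewrite /cexp; case: z w => x y [x' y'] /=.
by rewrite expRD rmorphM cisD mulrACA.
Qed.

Lemma normc_cexp z : normc (cexp z) = expR (Re z).
Proof. by rewrite Normc.normcM normc_real normc_cis mulr1 ger0_norm ?expR_ge0. Qed.

Lemma cexp_neq0 z : cexp z != 0.
Proof. by rewrite -normc_eq0 normc_cexp gt_eqF ?expR_gt0. Qed.

Lemma cexp_small e : 0 < e -> exists2 dl, 0 < dl &
  forall z, normc z < dl -> normc (cexp z - 1 - z) <= e * normc z.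
Proof.
(* The five error terms [t1] to [t5] contribute 1 + 2 + 3 + 1 + 1 = 8 times [e' * n]; the bound 1/2
   on [n] keeps the factors [1 + x] and [E] under control. *)
move=> e0; pose e' := Num.min (e / 8) (1 / 2).
have e'0 : 0 < e' by rewrite lt_min !divr_gt0.
have e'8 : 8 * e' <= e by rewrite mulrC -ler_pdivlMr // ge_min lexx.
have e'1 : e' <= 1 / 2 by rewrite ge_min lexx orbT.
have [d1 d10 h1] := is_derive_small (is_derive_expR 0) e'0.
have [d2 d20 h2] := is_derive_small (is_derive_cos 0) e'0.
have [d3 d30 h3] := is_derive_small (is_derive_sin 0) e'0.
have d0 : 0 < Num.min d1 (Num.min d2 d3) by rewrite !lt_min d10 d20.
exists (Num.min e' (Num.min d1 (Num.min d2 d3))); first by rewrite lt_min e'0 d0.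
case=> x y; rewrite lt_min 2!(lt_min _ d1, lt_min _ d2) => /and4P[ze z1 z2 z3].
have xz : `|x| <= normc (x +i* y) := normc_Re (x +i* y).
have yz : `|y| <= normc (x +i* y) := normc_Im (x +i* y).
have /h1 := le_lt_trans xz z1; rewrite !add0r expR0 mul1r.
have /h2 := le_lt_trans yz z2; rewrite !add0r cos0 sin0 oppr0 mul0r subr0.
have /h3 := le_lt_trans yz z3; rewrite !add0r sin0 cos0 mul1r subr0.
move: ze z1 z2 z3 xz yz; set n := normc (x +i* y) => ze z1 z2 z3 xz yz.
set E := expR x; set c := cos y; set s := sin y => hs hc hE.
apply: le_trans (normc_le _) _.
have -> : Re (cexp (x +i* y) - 1 - (x +i* y)) = (E - 1 - x) * c + (1 + x) * (c - 1).
  by rewrite /cexp /= -/E -/c -/s; ring.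
have -> : Im (cexp (x +i* y) - 1 - (x +i* y)) = E * (s - y) + (E - 1 - x) * y + x * y.
  by rewrite /cexp /= -/E -/c -/s; ring.
have c1 : `|c| <= 1 by rewrite ler_norml cos_geN1 cos_le1.
have n0 : 0 <= n by exact: normc_ge0.
have n1 : n <= 1 / 2 by rewrite (le_trans (ltW ze)).
have x1 : `|1 + x| <= 2 by rewrite (le_trans (ler_normD _ _)) // normr1; lra.
have hE' : `|E - 1 - x| <= e' * n by rewrite (le_trans hE) // ler_wpM2l // ltW.
have hc' : `|c - 1| <= e' * n by rewrite (le_trans hc) // ler_wpM2l // ltW.
have hs' : `|s - y| <= e' * n by rewrite (le_trans hs) // ler_wpM2l // ltW.
have en : e' * n <= 1 / 4.
  by rewrite (_ : 1 / 4 = 1 / 2 * (1 / 2)); [rewrite ler_pM // ltW|field].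
have E3 : `|E| <= 3.
  rewrite (_ : E = (E - 1 - x) + 1 + x); last by ring.
  have := ler_normD (E - 1 - x + 1) x; have := ler_normD (E - 1 - x) 1.
  rewrite normr1; lra.
have t1 : `|(E - 1 - x) * c| <= e' * n by rewrite normrM -[leRHS]mulr1 ler_pM.
have t2 : `|(1 + x) * (c - 1)| <= 2 * (e' * n) by rewrite normrM ler_pM.
have t3 : `|E * (s - y)| <= 3 * (e' * n) by rewrite normrM ler_pM.
have t4 : `|(E - 1 - x) * y| <= e' * n.
  by rewrite normrM -[leRHS]mulr1 ler_pM //; lra.
have t5 : `|x * y| <= e' * n by rewrite normrM ler_pM // (le_trans xz) // ltW.
have e8 : 8 * (e' * n) <= e * n by rewrite mulrA ler_wpM2r.
have := ler_normD ((E - 1 - x) * c) ((1 + x) * (c - 1)).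
have := ler_normD (E * (s - y) + (E - 1 - x) * y) (x * y).
have := ler_normD (E * (s - y)) ((E - 1 - x) * y).
lra.
Qed.

Lemma is_derive_cexp (z : C) : is_derive z 1 (cexp : C -> C) (cexp z).
Proof.
(* The slope of [cexp] at 0; the addition formula carries it to [z] as [cexp z * psi (w - z)]. *)
pose psi (t : C) : C := if t == 0 then 1 else (cexp t - 1) / t.
have psi0 : psi 0 = 1 by rewrite /psi eqxx.
have cpsi : {for (0 : C), continuous psi}.
  apply/continuousCP => e e0; have e20 : 0 < e / 2 by rewrite divr_gt0.
  have [dl dl0 h] := cexp_small e20; exists dl => // t; rewrite subr0 => tdl.
  rewrite psi0 /psi; case: eqP => [_|/eqP t0]; first by rewrite subrr Normc.normc0.
  have -> : (cexp t - 1) / t - 1 = (cexp t - 1 - t) / t by field.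
  have n0 : 0 < normc t by rewrite normc_gt0.
  rewrite Normc.normcM Normc.normcV ltr_pdivrMr //.
  by apply: le_lt_trans (h _ tdl) _; rewrite ltr_pM2r // ltr_pdivrMr // ltr_pMr // ltr1n.
pose phi (w : C) : C := cexp z * psi (w - z).
have <- : phi z = cexp z by rewrite /phi subrr psi0 mulr1.
apply: caratheodory_is_derive.
  apply: for_M; first exact: for_cst.
  apply: for_comp; last by rewrite subrr.
  by apply: for_B; [exact: for_id|exact: for_cst].
move=> w; rewrite /phi /psi subr_eq0.
case: eqP => [->|/eqP wz]; first by rewrite subrr mulr0 addr0.
rewrite -mulrA divfK ?subr_eq0 // mulrBr mulr1 -cexpD.
by rewrite [z + _]addrC subrK addrC subrK.
Qed.

Lemma is_derive_normc (G : C -> C) (z d : C) e : is_derive z 1 G d -> 0 < e ->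
  exists2 dl, 0 < dl & forall w, normc (w - z) < dl ->
    normc (G w - G z - d * (w - z)) <= e * normc (w - z).
Proof.
move=> /caratheodory[phi [cphi phiz GE]] e0.
have [dl dl0 h] := proj1 (continuousCP _ _) cphi e e0; exists dl => // w wz.
have -> : G w - G z - d * (w - z) = (phi w - phi z) * (w - z).
  by rewrite GE phiz; ring.
by rewrite Normc.normcM ler_wpM2r ?normc_ge0 // ltW // h.
Qed.

(** The two forms are the imaginary and real parts of [G dz]. The Cauchy-Riemann equations,
    contained in the multiplication by [d], make the cross coefficients agree. *)
Lemma holomorphic_closed_form (G : C -> C) (x0 y0 : R) (d : C) :
  is_derive (x0 +i* y0 : C) 1 G d ->
  closed_form_at (fun x y => Im (G (x +i* y))) (fun x y => Re (G (x +i* y))) x0 y0 /\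
  closed_form_at (fun x y => Re (G (x +i* y))) (fun x y => - Im (G (x +i* y))) x0 y0.
Proof.
move=> dG; have step e : 0 < e -> exists2 dl, 0 < dl & forall x y,
    `|x - x0| <= dl -> `|y - y0| <= dl ->
    normc (G (x +i* y) - G (x0 +i* y0) - d * ((x - x0) +i* (y - y0)))
      <= e * (`|x - x0| + `|y - y0|).
  move=> e0; have [dl dl0 h] := is_derive_normc dG e0.
  exists (dl / 3) => [|x y xx yy]; first by rewrite divr_gt0.
  have n := normc_le ((x - x0) +i* (y - y0)); rewrite /= in n.
  apply: le_trans (_ : e * normc ((x - x0) +i* (y - y0)) <= _).
    by apply: (h (x +i* y)) => /=; lra.
  by rewrite ler_wpM2l // ltW.
case: d dG step => a b dG step; split.
  exists b, a, (- b) => e /step[dl dl0 h]; exists dl => // x y xx yy.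
  have {}h := h x y xx yy; split; apply: le_trans h.
    apply: le_trans (normc_Im _); rewrite le_eqVlt; apply/orP; left; apply/eqP; congr `|_|.
    by case: (G _) => u v; case: (G _) => u' v' /=; ring.
  apply: le_trans (normc_Re _); rewrite le_eqVlt; apply/orP; left; apply/eqP; congr `|_|.
  by case: (G _) => u v; case: (G _) => u' v' /=; ring.
exists a, (- b), (- a) => e /step[dl dl0 h]; exists dl => // x y xx yy.
have {}h := h x y xx yy; split; apply: le_trans h.
  apply: le_trans (normc_Re _); rewrite le_eqVlt; apply/orP; left; apply/eqP; congr `|_|.
  by case: (G _) => u v; case: (G _) => u' v' /=; ring.
apply: le_trans (normc_Im _); rewrite le_eqVlt -normrN; apply/orP; left; apply/eqP; congr `|_|.
by case: (G _) => u v; case: (G _) => u' v' /=; ring.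
Qed.

(* [k] lifted by the exponential is a periodic entire function. *)
Lemma punctured_plane_limits (k : C -> C) (A B : C) :
  (forall z : C, z != 0 -> exists d : C, is_derive z 1 k d) ->
  (forall e, 0 < e -> exists2 dl, 0 < dl & forall z, z != 0 -> normc z < dl -> normc (k z - A) < e) ->
  (forall e, 0 < e -> exists M : R, forall z, M <= normc z -> normc (k z - B) < e) ->
  A = B.
Proof.
move=> dk kA kB; pose G (z : C) : C := k (cexp z).
have dG (z : C) : exists d : C, is_derive z 1 G d.
  have [phi [cphi phiz phiE]] := caratheodory (is_derive_cexp z).
  have [d /caratheodory[chi [cchi chiz chiE]]] := dk _ (cexp_neq0 z).
  exists (chi (cexp z) * phi z).
  apply: (@caratheodory_is_derive _ G z (fun w => chi (cexp w) * phi w)).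
    apply: for_M; last exact: cphi.
    by apply: for_comp; [exact: is_derive_continuous (is_derive_cexp z)|exact: cchi].
  move=> w; rewrite /G (chiE (cexp w)) -mulrA; congr (_ + _ * _).
  by rewrite phiE addrAC subrr add0r.
have period (x : R) : G (x +i* (2 * pi)) = G (x +i* 0).
  rewrite /G; congr k; rewrite (_ : x +i* (2 * pi) = x +i* 0 + 0 +i* (2 * pi)).
    by rewrite cexpD [X in _ * X]/cexp /= expR0 cis2pi !mulr1.
  by apply/eqP; rewrite eq_complex /= addr0 add0r !eqxx.
have T0 : 0 < 2 * pi :> R by rewrite mulr_gt0 // pi_gt0.
have GB e : 0 < e -> exists M : R, forall x y, M <= x -> normc (G (x +i* y) - B) <= e.
  move=> /kB[M hM]; exists M => x y Mx; rewrite ltW // hM // normc_cexp /=.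
  by apply: le_trans (expR_ge1Dx _); rewrite ler_wpDl.
have GA e : 0 < e -> exists M : R, forall x y, x <= M -> normc (G (x +i* y) - A) <= e.
  move=> /kA[dl dl0 h]; exists (ln dl - 1) => x y xM; rewrite ltW // h ?cexp_neq0 //.
  rewrite normc_cexp /= -[ltRHS]lnK ?posrE // ltr_expR; lra.
(* In the imaginary part of [G dz] the coefficient of [dy] is the real part of [G], so the vertical
   sides compare real parts; the real part of [G dz] then compares imaginary ones. *)
have Re_eq : Re B = Re A.
  apply: (@periodic_closed_form_limits R (fun x y => Im (G (x +i* y)))
    (fun x y => Re (G (x +i* y))) _ _ _ T0).
  - by move=> x y; have [d /holomorphic_closed_form[]] := dG (x +i* y).
  - by move=> x; rewrite period.
  - move=> e /GB[M h]; exists M => x y Mx; apply: le_trans (h x y Mx).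
    by rewrite -raddfB; exact: normc_Re.
  - move=> e /GA[M h]; exists M => x y Mx; apply: le_trans (h x y Mx).
    by rewrite -raddfB; exact: normc_Re.
have Im_eq : - Im B = - Im A.
  apply: (@periodic_closed_form_limits R (fun x y => Re (G (x +i* y)))
    (fun x y => - Im (G (x +i* y))) _ _ _ T0).
  - by move=> x y; have [d /holomorphic_closed_form[]] := dG (x +i* y).
  - by move=> x; rewrite period.
  - move=> e /GB[M h]; exists M => x y Mx; apply: le_trans (h x y Mx).
    by rewrite -opprD normrN -raddfB; exact: normc_Im.
  - move=> e /GA[M h]; exists M => x y Mx; apply: le_trans (h x y Mx).
    by rewrite -opprD normrN -raddfB; exact: normc_Im.
by apply/eqP; rewrite eq_complex Re_eq -(inj_eq oppr_inj (Im A)) Im_eq !eqxx.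
Qed.

Lemma entire_affine (h : C -> C) (c : C) :
  (forall z : C, exists d : C, is_derive z 1 h d) ->
  (forall e, 0 < e -> exists M : R, forall z, M <= normc z -> normc (h z / z - c) < e) ->
  forall z, h z = h 0 + c * z.
Proof.
move=> dh hc.
have dhc (a : C) : is_derive a 1 h c.
  have [d da] := dh a; suff <- : d = c by [].
  have [phi [cphi phia phiE]] := caratheodory da.
  apply: (@punctured_plane_limits (fun z => (h (a + z) - h a) / z)).
  - move=> z z0; have [d' /caratheodory[chi [cchi chiz chiE]]] := dh (a + z).
    (* The slope at [z] of the difference quotient, by the quotient rule. The identity needs
       [w != 0], hence holds only near [z]. *)
    pose xi (w : C) : C := (z * chi (a + w) - (h (a + z) - h a)) / (w * z).
    exists (xi z); apply: near_caratheodory.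
      apply: for_M.
        apply: for_B; last exact: for_cst.
        apply: for_M; first exact: for_cst.
        apply: for_comp; last exact: cchi.
        by apply: for_D; [exact: for_cst|exact: for_id].
      apply: for_V; first by rewrite mulf_neq0.
      by apply: for_M; [exact: for_id|exact: for_cst].
    have : \forall w \near z, w != 0.
      apply/nbhsCP; exists (normc z); first by rewrite normc_gt0.
      by move=> w; apply: contraTneq => ->; rewrite sub0r normcN ltxx.
    apply: filterS => w w0; rewrite /xi (chiE (a + w)).
    have -> : a + w - (a + z) = w - z by ring.
    by field; rewrite w0 z0.
  - move=> e e0; have [dl dl0 hphi] := proj1 (continuousCP _ _) cphi e e0.
    exists dl => // z z0 zdl; rewrite phiE -phia.
    have -> : (h a + phi (a + z) * (a + z - a) - h a) / z = phi (a + z) by field.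
    by apply: hphi; rewrite [a + z]addrC addrK.
  - move=> e e0; have [M hM] := hc (e / 4) ltac:(by rewrite divr_gt0).
    pose N := normc (c * a - h a).
    have N0 : 0 <= N by exact: normc_ge0.
    have a0 := normc_ge0 a.
    (* The three bounds give [|a + z| >= M], then [|a + z| <= 2 |z|] with [z] and [a + z] nonzero,
       then a remainder of at most [e / 4]; the total is [3 e / 4]. *)
    exists (Num.max (M + normc a) (Num.max (normc a + 1) (4 * N / e))) => z.
    rewrite !ge_max => /and3P[z1 z2 z3].
    have z0 : 0 < normc z by lra.
    have zn0 : z != 0 by rewrite -normc_gt0.
    have az : normc z <= normc (a + z) + normc a.
      by have := normcD (a + z) (- a); rewrite addrAC subrr add0r normcN.
    have az0 : a + z != 0 by rewrite -normc_gt0; lra.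
    have -> : (h (a + z) - h a) / z - c =
        (h (a + z) / (a + z) - c) * ((a + z) / z) + (c * a - h a) / z.
      by field; rewrite zn0 az0.
    apply: le_lt_trans (normcD _ _) _.
    rewrite !Normc.normcM Normc.normcV -/N.
    have h1 : normc (h (a + z) / (a + z) - c) < e / 4 by apply: hM; lra.
    have h2 : normc (a + z) / normc z <= 2.
      by rewrite ler_pdivrMr // (le_trans (normcD _ _)) //; lra.
    have h3 : N / normc z <= e / 4.
      rewrite ler_pdivrMr //; move: z3; rewrite ler_pdivrMr //; lra.
    have h4 : normc (h (a + z) / (a + z) - c) * (normc (a + z) / normc z) <= e / 4 * 2.
      by rewrite ler_pM ?normc_ge0 ?divr_ge0 ?normc_ge0 // ltW.
    lra.
move=> z.
(* The mean value theorem is real, so it is applied along the segment from 0 to [z] to the real and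
   imaginary parts of [h z - c * z]; [F] stands for either. *)
have ray (F : R[i] -> R) : (forall u v, F (u - v) = F u - F v) ->
    (forall u, `|F u| <= normc u) -> (forall (t : R) u, F (t%:C * u) = t * F u) ->
    F (h z - c * z) = F (h 0).
  move=> FB Fn FZ; pose u (t : R) : R := F (h (t%:C * z) - c * (t%:C * z)).
  have du (t : R) : is_derive t 1 u 0.
    have [phi [cphi phic phiE]] := caratheodory (dhc (t%:C * z)).
    pose xi (s : R) : R := F ((phi (s%:C * z) - c) * z).
    have xit : xi t = 0 by rewrite /xi phic subrr mul0r -(subrr 0) FB subrr.
    rewrite -xit; apply: (@caratheodory_is_derive R).
      apply/cvgrPdist_le => e e0; rewrite xit.
      have z1 : 0 < normc z + 1 by rewrite ltr_wpDl ?normc_ge0.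
      have [dl dl0 hphi] := proj1 (continuousCP _ _) cphi (e / (normc z + 1)) ltac:(by rewrite divr_gt0).
      apply/nbhs_ballP; exists (dl / (normc z + 1)) => /=; first by rewrite divr_gt0.
      move=> s; rewrite /ball /= distrC => st.
      rewrite sub0r normrN (le_trans (Fn _)) // Normc.normcM -phic.
      have /hphi/ltW h1 : normc (s%:C * z - t%:C * z) < dl.
        rewrite -mulrBl -rmorphB Normc.normcM normc_real.
        apply: le_lt_trans (_ : `|s - t| * (normc z + 1) < _).
          by rewrite ler_wpM2l // lerDl.
        by rewrite -ltr_pdivlMr.
      apply: le_trans (_ : e / (normc z + 1) * (normc z + 1) <= _).
        by rewrite ler_pM ?normc_ge0 // lerDl.
      by rewrite divfK // gt_eqF.
    move=> s; rewrite /u /xi.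
    have -> : F ((phi (s%:C * z) - c) * z) * (s - t) =
        F ((s - t)%:C * ((phi (s%:C * z) - c) * z)) by rewrite FZ mulrC.
    apply/eqP; rewrite addrC -subr_eq -FB; apply/eqP; congr F.
    by rewrite phiE rmorphB; ring.
  have := @mvt_diff R u (fun=> 0) (fun=> 0) (fun=> 0) 0 0 1 ler01
    (fun t _ => du t) (fun t _ => is_derive_cst 0 t 1) (fun _ _ => _).
  rewrite subrr normr0 mul0r => /(_ (fun=> lexx 0)); rewrite !subr0 normr_le0 subr_eq0.
  by rewrite /u rmorph0 rmorph1 !mul0r mul1r mulr0 subr0 => /eqP.
have /eqP hRe : Re (h z - c * z) = Re (h 0).
  apply: ray; [by move=> *; rewrite raddfB|exact: normc_Re|].
  by move=> t [x y] /=; ring.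
have /eqP hIm : Im (h z - c * z) = Im (h 0).
  apply: ray; [by move=> *; rewrite raddfB|exact: normc_Im|].
  by move=> t [x y] /=; ring.
apply/eqP; rewrite -subr_eq; rewrite eq_complex; apply/andP; split=> //.
Qed.

End Liouville.

(** * Topology of the sphere *)

Section SphereTopology.
Variable R : realType.
Local Notation C := R[i]^o.
Implicit Types (b : bool) (z w : R[i]) (s t : sphere R) (f g h m : sphere R -> sphere R).
Local Notation normc := (@Normc.normc R).
Local Notation Re := (@complex.Re R).
Local Notation Im := (@complex.Im R).

Lemma normc_lipschitz z w : `|normc z - normc w| <= normc (z - w).
Proof.
rewrite ler_norml; apply/andP; split.
  by have := normcD (w - z) z; rewrite subrK normcB; lra.
by have := normcD (z - w) w; rewrite subrK; lra.
Qed.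

Lemma continuous_normc : continuous (normc : C -> R).
Proof.
move=> z U /nbhs_ballP[e /= e0 sub]; apply/nbhsCP; exists e => // w wz; apply: sub.
by rewrite /ball /= (le_lt_trans (normc_lipschitz _ _)) // normcB.
Qed.

Lemma compact_normc_bounded (K : set C) : compact K -> exists M : R, forall z, K z -> normc z <= M.
Proof.
move=> cK; have /compact_bounded[M [_ hM]] : compact ((normc : C -> R) @` K).
  apply: continuous_compact => //; apply: continuous_subspaceT; exact: continuous_normc.
exists (M + 1) => z Kz; rewrite -[normc z]ger0_norm ?normc_ge0 //.
by apply: (hM (M + 1)); [rewrite ltrDl|exists z].
Qed.

Lemma closed_normc_ball (M : R) : closed [set z : C | normc z <= M].
Proof.
by apply: (@closed_comp _ _ (normc : C -> R) [set x | x <= M]);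
  [move=> z _; exact: continuous_normc|exact: closed_le].
Qed.

Lemma compact_normc_ball (M : R) : compact [set z : C | normc z <= M].
Proof.
pose F (p : R * R) : C := p.1 +i* p.2.
have cF : continuous F.
  move=> [x y] U /nbhsCP[dl dl0 sub]; apply/nbhs_ballP; exists (dl / 2) => /=.
    by rewrite divr_gt0.
  move=> [x' y'] [/= xx yy]; apply: sub.
  apply: le_lt_trans (normc_le _) _ => /=.
  by move: xx yy; rewrite /ball /= ![`|x - _|]distrC ![`|y - _|]distrC; lra.
have cB : compact (`[- M, M]%classic `*` `[- M, M]%classic : set (R * R)).
  by apply: compact_setX; exact: segment_compact.
apply: (subclosed_compact (@closed_normc_ball M)
  (continuous_compact (continuous_subspaceT cF) cB)).
move=> [x y] /= xyM; exists (x, y) => //=; rewrite !in_itv /= -!ler_norml.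
by split; [exact: le_trans (normc_Re (x +i* y)) xyM|exact: le_trans (normc_Im (x +i* y)) xyM].
Qed.

Lemma nbhs_Some z (U : set (sphere R)) : nbhs (Some z : sphere R) U = nbhs (z : C) (fun w => U (Some w)).
Proof. by []. Qed.

(** Compact sets of the plane are bounded, and closed discs are compact and closed: discs are
    cofinal among the compact sets removed. *)
Lemma nbhs_None (U : set (sphere R)) : nbhs (None : sphere R) U <->
  U None /\ exists M : R, forall z, M < normc z -> U (Some z).
Proof.
split.
  move=> [K [cK _] sub]; split; first by apply: sub; right.
  have [M hM] := compact_normc_bounded cK; exists M => z Mz; apply: sub; left.
  by exists z => // /hM; rewrite leNgt Mz.
move=> [U0 [M hM]]; exists [set z : C | normc z <= M].
  by split; [exact: compact_normc_ball|exact: closed_normc_ball].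
by move=> _ [[z /negP] + <-|->] //; rewrite -ltNge; exact: hM.
Qed.

Lemma continuous_inversion : continuous (@inversion R).
Proof.
case=> [z|] U; last first.
  move=> /= /nbhsCP[dl dl0 sub]; apply/nbhs_None; split=> /=.
    by apply: sub; rewrite subrr Normc.normc0.
  exists dl^-1 => w wdl /=.
  have w0 : 0 < normc w by rewrite (lt_trans _ wdl) // invr_gt0.
  have wn0 : w != 0 by rewrite -normc_gt0.
  rewrite (negPf wn0); apply: sub; rewrite subr0 Normc.normcV.
  by rewrite invf_plt ?posrE.
rewrite nbhs_simpl /=; case: eqP => [->|/eqP z0].
  move=> /nbhs_None[U0 [M hM]]; apply/nbhsCP; exists (`|M| + 1)^-1.
    by rewrite invr_gt0 ltr_wpDl.
  move=> w; rewrite subr0 => wM /=; case: eqP => // /eqP w0.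
  apply: hM; rewrite Normc.normcV.
  have M1 : M < `|M| + 1 by rewrite (le_lt_trans (ler_norm M)) // ltrDl.
  by apply: lt_trans M1 _; rewrite -invf_pgt ?posrE ?normc_gt0 // ltr_wpDl.
rewrite nbhs_Some => nU.
have : nbhs (z : C) (fun w => U (Some w^-1)) by exact: (@cvgV C C (nbhs (z : C)) _ id z z0 cvg_id _ nU).
have : nbhs (z : C) (fun w => w != 0).
  apply/nbhsCP; exists (normc z); first by rewrite normc_gt0.
  by move=> w; apply: contraTneq => ->; rewrite sub0r normcN ltxx.
by apply: filterS2 => w w0 /=; rewrite (negPf w0).
Qed.

Lemma continuous_chart b : continuous (@chart R b).
Proof. by case: b; [exact: continuous_inversion|move=> s; exact: cvg_id]. Qed.

Lemma continuous_in_charts f s b (b' : bool) z (phi : C -> C) :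
  chart b s = Some z -> {for (z : C), continuous phi} ->
  (\forall w \near (z : C), chart b' (f (chart b (Some w))) = Some (phi w)) ->
  {for s, continuous f}.
Proof.
move=> sz cphi fphi.
have fE : f = chart b' \o (chart b' \o f \o chart b) \o chart b.
  by apply/funext => t /=; rewrite !chartK.
rewrite fE; apply: continuous_comp; first exact: continuous_chart.
apply: continuous_comp; last exact: continuous_chart.
rewrite sz => U; rewrite nbhs_simpl /= (nbhs_singleton fphi) => nU.
have := cphi _ nU; rewrite nbhs_simpl /= => h.
by move: fphi h; apply: filterS2 => w /= <-.
Qed.

(** The difference quotient, at increment [u], of a homography with derivative [D]; the pole lies
    where [1 + k * u = 0]. This closed form yields continuity, conformality and the local degree. *)
Definition hom_quot (D k u : R[i]) : C := D / (1 + k * u).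

Lemma isMob_local m z w : isMob m -> m (Some z) = Some w -> exists D k, D != 0 /\
  forall u, 1 + k * u != 0 -> m (Some (z + u)) = Some (w + hom_quot D k u * u).
Proof.
move=> [a [b [c [d [D0 ->]]]]] /=; case: eqP => // /eqP e0 [<-].
exists ((a * d - b * c) / (c * z + d) ^+ 2), (c / (c * z + d)); split.
  by rewrite mulf_neq0 // invr_neq0 // expf_neq0.
move=> u; have -> : 1 + c / (c * z + d) * u = (c * (z + u) + d) / (c * z + d).
  by field.
rewrite mulf_eq0 invr_eq0 (negPf e0) orbF => e1; rewrite (negPf e1); congr Some.
rewrite /hom_quot; have -> : 1 + c / (c * z + d) * u = (c * (z + u) + d) / (c * z + d).
  by field.
by field; rewrite e0 e1.
Qed.

Lemma for_hom_quot D k z : {for (z : C), continuous (fun w : C => hom_quot D k (w - z))}.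
Proof.
apply: for_M; first exact: for_cst.
apply: for_V; first by rewrite subrr mulr0 addr0 oner_neq0.
apply: for_D; first exact: for_cst.
apply: for_M; first exact: for_cst.
by apply: for_B; [exact: for_id|exact: for_cst].
Qed.

Lemma near_hom_denominator k z : \forall w \near (z : C), 1 + k * (w - z) != 0.
Proof.
apply/nbhsCP; exists (normc k + 1)^-1; first by rewrite invr_gt0 ltr_wpDl ?normc_ge0.
move=> w wz; apply/eqP => e0.
have : normc (k * (w - z)) = 1.
  by rewrite -normcN -(Normc.normc1 R) -(subr0 1) -e0; congr normc; ring.
rewrite Normc.normcM => k1.
have : normc (w - z) * (normc k + 1) < 1 by rewrite -ltr_pdivlMr ?div1r // ltr_wpDl ?normc_ge0.
by rewrite mulrDr mulr1 mulrC k1 gtrDl ltNge normc_ge0.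
Qed.

Lemma isMob_near m z w : isMob m -> m (Some z) = Some w -> exists D k, D != 0 /\
  \forall v \near (z : C), m (Some v) = Some (w + hom_quot D k (v - z) * (v - z)).
Proof.
move=> mm mz; have [D [k [D0 mE]]] := isMob_local mm mz; exists D, k; split=> //.
apply: filterS (near_hom_denominator k z) => v /mE <-.
by rewrite addrC subrK.
Qed.

Lemma chart_surj s : exists b z, chart b s = Some z.
Proof. by case: s => [z|]; [exists false, z|exists true, 0]. Qed.

(** Charts are homographies themselves, so the behaviour at infinity or at a pole reduces to
    [isMob_local] at finite points. *)
Lemma isMob_in_charts b (b' : bool) m : isMob m -> isMob (chart b' \o m \o chart b).
Proof. by move=> mm; apply: isMob_comp (isMob_chart _ _); apply: isMob_comp mm; exact: isMob_chart. Qed.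

Lemma isMob_continuous m : isMob m -> continuous m.
Proof.
move=> mm s; have [b [z sz]] := chart_surj s; have [b' [w msw]] := chart_surj (m s).
have mz : (chart b' \o m \o chart b) (Some z) = Some w by rewrite /= -sz chartK.
have [D [k [_ mE]]] := isMob_near (isMob_in_charts b b' mm) mz.
apply: (continuous_in_charts sz _ mE); apply: for_D; first exact: for_cst.
apply: for_M; first exact: for_hom_quot.
by apply: for_B; [exact: for_id|exact: for_cst].
Qed.

Lemma conj_sphereK : involutive (@conj_sphere R).
Proof. by case=> [z|] //=; rewrite conjcK. Qed.

Lemma conj_chart b s : conj_sphere (chart b s) = chart b (conj_sphere s).
Proof.
case: b => [|//]; case: s => [z|]; last by congr Some; exact: conjc0.
by rewrite /= fmorph_eq0; case: eqP => //= _; rewrite fmorphV.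
Qed.

Lemma normc_conj z : normc (conjc z) = normc z.
Proof. by case: z => x y /=; rewrite sqrrN. Qed.

Lemma continuous_conjc : continuous (conjc : C -> C).
Proof.
move=> z; apply/continuousCP => e e0; exists e => // w wz.
by rewrite -rmorphB normc_conj.
Qed.

Lemma continuous_conj_sphere : continuous (@conj_sphere R).
Proof.
move=> s; have [b [z sz]] := chart_surj s.
apply: (@continuous_in_charts _ s b b z conjc sz); first exact: continuous_conjc.
by near=> w; rewrite -conj_chart chartK.
Unshelve. all: by end_near. Qed.

Lemma isMob_conformal m s : isMob m -> conformal_at m s.
Proof.
move=> mm b b' z w sz msw.
have mz : (chart b' \o m \o chart b) (Some z) = Some w by rewrite /= -sz chartK.
have [D [k [D0 mE]]] := isMob_near (isMob_in_charts b b' mm) mz.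
exists D; split=> //; have -> : D = hom_quot D k (z - z) by rewrite /hom_quot subrr mulr0 addr0 divr1.
apply: (@near_caratheodory _ _ (z : C) (fun v => hom_quot D k (v - z))).
  exact: for_hom_quot.
have inE v : in_charts b b' m v = odflt 0 ((chart b' \o m \o chart b) (Some v)) by [].
by apply: filterS mE => v; rewrite !inE mz => ->.
Qed.

Lemma isMob_homeomorphism m : isMob m -> homeomorphism m.
Proof.
move=> mm; have [g [mg mK gK]] := isMob_inv mm.
by exists g; split=> //; exact: isMob_continuous.
Qed.

Lemma homeomorphism_comp f g : homeomorphism f -> homeomorphism g -> homeomorphism (f \o g).
Proof.
move=> [f' [cf cf' fK f'K]] [g' [cg cg' gK g'K]]; exists (g' \o f'); split.
- by move=> s; apply: continuous_comp; [exact: cg|exact: cf].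
- by move=> s; apply: continuous_comp; [exact: cf'|exact: cg'].
- by move=> s /=; rewrite fK gK.
- by move=> s /=; rewrite g'K f'K.
Qed.

Lemma conj_sphere_homeomorphism : homeomorphism (@conj_sphere R).
Proof.
exists (@conj_sphere R); split; [exact: continuous_conj_sphere|exact: continuous_conj_sphere| |];
  exact: conj_sphereK.
Qed.

Lemma isMob_conj m : isMob m -> isMob (@conj_sphere R \o m \o @conj_sphere R).
Proof.
move=> [a [b [c [d [D ->]]]]]; exists a^*%C, b^*%C, c^*%C, d^*%C; split.
  by rewrite -!rmorphM -rmorphB fmorph_eq0.
apply/funext => -[z|] /=; last first.
  by rewrite fmorph_eq0; case: eqP => //= _; rewrite fmorph_div.
have -> : c^*%C * z + d^*%C = (c * z^*%C + d)^*%C by rewrite rmorphD rmorphM /= conjcK.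
rewrite fmorph_eq0; case: eqP => //= _; rewrite fmorph_div; congr (Some (_ / _)).
by rewrite rmorphD rmorphM /= conjcK.
Qed.

Lemma cst_compact_open_continuous : continuous (fun s => cst s : sphere_maps R).
Proof.
move=> s; have FF : Filter (nbhs (s : sphere R)) by exact: nbhs_filter.
apply/compact_open_cvgP => K O cK oO sub.
change (nbhs s (fun t => (cst t : sphere R -> sphere R) @` K `<=` O)).
have [K0|/set0P[t Kt]] := eqVneq K set0.
  by apply: nearW => t /=; rewrite K0 image_set0.
have Os : O s by apply: sub; exists t.
have : nbhs s O by exact: open_nbhs_nbhs.
by apply: filterS => r Or _ [? _ <-].
Qed.

Lemma eval_compact_open_continuous s : continuous (fun f : sphere_maps R => f s).
Proof.
move=> f U; rewrite nbhsE => -[V [oV Vfs] VU].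
have : nbhs f [set g : sphere_maps R | g @` [set s] `<=` V].
  apply: open_nbhs_nbhs; split; first by apply: compact_open_open => //; exact: compact_set1.
  by move=> _ [_ -> <-].
by apply: filterS => g gV; apply: VU; apply: gV; exists s.
Qed.

Lemma comp_compact_open_continuous f g : continuous f -> continuous g ->
  continuous ((fun h => f \o h \o g) : sphere_maps R -> sphere_maps R).
Proof.
move=> cf cg h; have FF : Filter (nbhs (h : sphere_maps R)) by exact: nbhs_filter.
apply/compact_open_cvgP => K O cK oO sub.
have : nbhs h [set h' : sphere_maps R | h' @` (g @` K) `<=` f @^-1` O].
  apply: open_nbhs_nbhs; split.
    apply: compact_open_open; last by apply: open_comp.
    by apply: continuous_compact => //; exact: continuous_subspaceT.
  by move=> _ [_ [t Kt <-] <-]; apply: sub; exists t.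
by apply: filterS => h' h'O _ [t Kt <-] /=; apply: h'O; exists (g t) => //; exists t.
Qed.

(** [f] is the embedding of constants, then [rho], then evaluation at [None], and each of the three
    is continuous. *)
Lemma induced_continuous (R1 R2 : sphere R -> sphere R) rho f :
  continuous_isomorphism R1 R2 rho -> induced_on_constants rho f -> continuous f.
Proof.
move=> [_ /subspace_continuousP crho] rhof s.
move=> U nU; have rs := rhof s.
have nV : nbhs (rho (cst s)) (fun h : sphere_maps R => U (h None)).
  by apply: eval_compact_open_continuous; rewrite rs.
have := crho _ (RatMaps_cst s) _ nV.
move=> /(@cst_compact_open_continuous s).
have FF : Filter (nbhs (s : sphere R)) by exact: nbhs_filter.
change (nbhs s (fun t => RatMaps (cst t) -> U (rho (cst t) None)) ->
  nbhs s (fun t => U (f t))).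
by apply: filterS => t /(_ (RatMaps_cst t)); rewrite rhof.
Qed.

End SphereTopology.

(** * Conformal homeomorphisms *)

Section ConformalRigidity.
Variable R : realType.
Local Notation C := R[i]^o.
Implicit Types (b : bool) (z w : R[i]) (s t : sphere R) (f g h m : sphere R -> sphere R).
Local Notation normc := (@Normc.normc R).

(** Continuity keeps nearby images inside the target chart, so the default value in [in_charts] is
    never reached there. *)
Lemma near_in_charts f s b b' z w : {for s, continuous f} ->
  chart b s = Some z -> chart b' (f s) = Some w ->
  \forall v \near (z : C), chart b' (f (chart b (Some v))) = Some (in_charts b b' f v).
Proof.
move=> cf sz fsw.
have cF : {for (Some z : sphere R), continuous (chart b' \o f \o chart b)}.
  apply: continuous_comp; first exact: continuous_chart.
  apply: continuous_comp; last exact: continuous_chart.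
  by rewrite -sz chartK.
have FE : (chart b' \o f \o chart b) (Some z) = Some w by rewrite /= -sz chartK.
have : nbhs (Some w : sphere R) [set t | t <> None].
  by rewrite nbhs_Some; near=> v.
rewrite -FE => /cF; rewrite nbhs_simpl /= nbhs_Some.
by apply: filterS => v /=; rewrite /in_charts; case: (chart b' _).
Unshelve. all: by end_near. Qed.

(** The chain rule as a product of slopes, through an intermediate chart [b2] around [f s]. *)
Lemma conformal_at_mob m f s : isMob m -> {for s, continuous f} ->
  conformal_at f s -> conformal_at (m \o f) s.
Proof.
move=> mm cf conf b b' z w sz mfsw; have [b2 [v fsv]] := chart_surj (f s).
have [d [d0 /caratheodory[phi [cphi phiz phiE]]]] := conf b b2 z v sz fsv.
have mv : (chart b' \o m \o chart b2) (Some v) = Some w by rewrite /= -fsv chartK.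
have [D [k [D0 mE]]] := isMob_near (isMob_in_charts b2 b' mm) mv.
set xi := in_charts b b2 f in phiE.
have xiz : xi z = v by rewrite /xi /in_charts -sz chartK fsv.
have cxi : {for (z : C), continuous (xi : C -> C)}.
  have -> : xi = fun w => xi z + phi w * (w - z) by apply/funext => u; rewrite phiE.
  apply: for_D; first exact: for_cst.
  apply: for_M; first exact: cphi.
  by apply: for_B; [exact: for_id|exact: for_cst].
exists (D * d); split; first by rewrite mulf_neq0.
pose chi (t : C) : C := hom_quot D k (xi t - v) * phi t.
have -> : D * d = chi z.
  by rewrite /chi xiz subrr /hom_quot mulr0 addr0 divr1 phiz.
apply: near_caratheodory.
  apply: for_M; last exact: cphi.
  apply: (@for_comp _ (fun u : C => hom_quot D k (u - v)) xi); first exact: cxi.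
  by rewrite xiz; exact: for_hom_quot.
have mfz : in_charts b b' (m \o f) z = w by rewrite /in_charts /= -sz chartK mfsw.
rewrite -xiz in mE; have := cxi _ mE; rewrite nbhs_simpl /=.
have := near_in_charts cf sz fsv; apply: filterS2 => t tE.
rewrite mfz /chi {1}/in_charts /= -[f (chart b (Some t))](chartK b2) tE -/(xi t) => -> /=.
have e : xi t - xi z = phi t * (t - z) by rewrite (phiE t) addrAC subrr add0r.
by rewrite -xiz e; ring.
Qed.

(** Once infinity is fixed the map is entire, and its nonzero derivative [d] at infinity, read in
    the chart [1 / z], says that [h z / z] tends to [1 / d]. *)
Lemma conformal_homeomorphism_mob f : homeomorphism f ->
  (forall s, conformal_at f s) -> isMob f.
Proof.
move=> [f' [cf _ fK f'K]] conf.
have [m [mm _ moo]] : exists m, [/\ isMob m, m (f (Some 0)) = Some 0 & m (f None) = None].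
  by apply: mob_to0oo; apply/eqP => /(can_inj fK).
pose g := m \o f; have cg : continuous g.
  by move=> s; apply: continuous_comp; [exact: cf|exact: isMob_continuous].
have ginj : injective g by apply: inj_comp; [exact: isMob_inj|exact: can_inj fK].
have confg s : conformal_at g s by apply: conformal_at_mob => //; exact: cf.
have goo : g None = None by [].
pose h := in_charts false false g.
have gE z : g (Some z) = Some (h z).
  rewrite /h /in_charts /=; case gz: (g (Some z)) => [w|] //.
  by have /ginj : g (Some z) = g None by rewrite gz goo.
have [d [d0 /caratheodory[phi [cphi phi0 phiE]]]] :=
  confg None true true 0 0 erefl ltac:(by rewrite goo).
set psi := in_charts true true g in phiE.
have psi0 : psi 0 = 0 by rewrite /psi /in_charts /= eqxx goo.
have psiE z : z != 0 -> psi z = (h z^-1)^-1.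
  move=> z0; rewrite /psi /in_charts /= (negPf z0) gE /=.
  (* Where [h] vanishes the image leaves the chart, and the default 0 agrees with the convention for
     the inverse of 0. *)
  by case: eqP => [->|//]; rewrite invr0.
have hE z : h z = h 0 + d^-1 * z.
  apply: (@entire_affine R h d^-1) => [{}z|e e0].
    by have [c [_ dh]] := confg (Some z) false false z (h z) erefl (gE z); exists c.
  have cphiV : {for (0 : C), continuous (fun w : C => (phi w)^-1 : C)}.
    by apply: for_V; rewrite ?phi0.
  have [dl dl0 hdl] := proj1 (continuousCP _ _) cphiV e e0.
  (* The [+ 1] makes the modulus of [1 / w] strictly smaller than [dl]. *)
  exists (dl^-1 + 1) => w wdl; have w0 : w != 0.
    by rewrite -normc_gt0 (lt_le_trans _ wdl) // ltr_pwDr // invr_ge0 ltW.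
  have -> : h w / w = (phi w^-1)^-1.
    have := phiE w^-1; rewrite psiE ?invr_eq0 // psi0 add0r subr0 invrK => hw.
    by rewrite -[h w]invrK hw invfM invrK mulfK.
  rewrite -phi0; apply: hdl; rewrite subr0 Normc.normcV invf_plt ?posrE ?normc_gt0 //.
  by rewrite (lt_le_trans _ wdl) // ltrDl.
have [m' [mm' mK _]] := isMob_inv mm.
have -> : f = m' \o g by apply/funext => s; rewrite /g /= mK.
apply: isMob_comp => //.
have -> : g = mob d^-1 (h 0) 0 1.
  apply/funext => -[z|]; last by rewrite goo mob_affineoo.
  by rewrite gE mob_affine hE addrC.
by apply: isMob_affine; rewrite invr_neq0.
Qed.

Lemma anticonformalP f : anticonformal_homeomorphism f <-> isMob (@conj_sphere R \o f).
Proof.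
split=> [[hf conf]|mf].
  by apply: conformal_homeomorphism_mob => //; exact: homeomorphism_comp (conj_sphere_homeomorphism R) hf.
split; last by move=> s; exact: isMob_conformal.
have -> : f = @conj_sphere R \o (@conj_sphere R \o f).
  by apply/funext => s /=; rewrite conj_sphereK.
by apply: homeomorphism_comp; [exact: conj_sphere_homeomorphism|exact: isMob_homeomorphism].
Qed.

End ConformalRigidity.

(** * Local degree *)

Section Winding.
Variable R : realType.
Local Notation C := R[i]^o.
Implicit Types (b : bool) (z w : R[i]) (s : sphere R) (f m : sphere R -> sphere R).
Local Notation normc := (@Normc.normc R).
Local Notation Re := (@complex.Re R).
Local Notation Im := (@complex.Im R).

Lemma cis_neq0 (t : R) : cis t != 0.
Proof. by rewrite -normc_eq0 normc_cis oner_eq0. Qed.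

Lemma cis0 : cis 0 = 1 :> R[i].
Proof. by rewrite /cis cos0 sin0. Qed.

Lemma cisN (t : R) : cis (- t) = (cis t)^-1.
Proof.
by apply: (mulIf (cis_neq0 t)); rewrite -cisD addNr cis0 mulVf ?cis_neq0.
Qed.

Lemma polar_norm z (rho t : R) : 0 <= rho -> z = rho%:C * cis t -> z = `|z| * cis t.
Proof.
move=> r0 zE; rewrite normcE {2}zE Normc.normcM normc_cis mulr1 normc_real.
by rewrite ger0_norm.
Qed.

(** On the right half-plane this argument is explicit and continuous, which [polar] does not
    provide. *)
Lemma polar_right z : 0 < Re z -> z = `|z| * cis (atan (Im z / Re z)).
Proof.
case: z => x y /= x0; set t := atan _.
have ct : 0 < cos t by rewrite /t cos_atan invr_gt0 sqrtr_gt0 ltr_pwDl // sqr_ge0.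
apply: (@polar_norm _ (x / cos t)); first by rewrite divr_ge0 // ltW.
have st : sin t = y / x * cos t.
  by rewrite -[y / x](atanK) -/t /tan divfK // gt_eqF.
apply/eqP; rewrite eq_complex /= !mul0r subr0 addr0 st; apply/andP; split; apply/eqP.
  by rewrite divfK // gt_eqF.
by field; rewrite !gt_eqF.
Qed.

Lemma polar z : exists t : R, z = `|z| * cis t.
Proof.
have cispi : cis pi = -1 :> R[i].
  by rewrite /cis cospi sinpi; apply/eqP; rewrite eq_complex /= oppr0 !eqxx.
have [z0|z0|z0] := ltgtP (Re z) 0.
- have h : 0 < Re (- z) by case: z z0 => x y /=; rewrite oppr_gt0.
  exists (atan (Im (- z) / Re (- z)) + pi).
  by rewrite cisD cispi mulrN1 mulrN -{1}[z]opprK {1}(polar_right h) normrN.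
- by exists (atan (Im z / Re z)); exact: polar_right.
- case: z z0 => x y /= ->; have [y0|y0] := leP 0 y.
    exists (pi / 2); apply: (@polar_norm _ y) => //.
    by apply/eqP; rewrite eq_complex /= cos_pihalf sin_pihalf !(mulr0, mul0r, mulr1, subr0, addr0) !eqxx.
  exists (- (pi / 2)); apply: (@polar_norm _ (- y)); first by rewrite oppr_ge0 ltW.
  apply/eqP; rewrite eq_complex /= cosN sinN cos_pihalf sin_pihalf.
  by rewrite !(mulr0, mul0r, mulrNN, mulr1, subr0, addr0) !eqxx.
Qed.

(** The difference of two arguments has cosine 1 throughout. If it changed by a nonzero multiple of
    [2 * pi], it would pass half a turn from its start, where the cosine is -1. *)
Lemma winding_unique (gamma : R -> R[i]) w (n n' : int) :
  winding_number gamma w n -> winding_number gamma w n' -> n = n'.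
Proof.
move=> [gw [th [cth thE thn]]] [_ [th' [cth' th'E th'n]]].
pose dl t := th t - th' t.
have cosdl t : 0 <= t <= 1 -> cos (dl t) = 1.
  move=> t01; suff : cis (dl t) = 1 by case.
  rewrite /dl cisD cisN; apply: (mulIf (cis_neq0 (th' t))); rewrite mul1r divfK ?cis_neq0 //.
  apply: (@mulfI _ `|gamma t - w|); first by rewrite normr_eq0 subr_eq0 gw.
  by rewrite -thE // -th'E.
have cdl : {within `[0, 1], continuous dl}.
  by move=> x; apply: continuousB; [exact: cth|exact: cth'].
have pi0 : 0 < pi :> R := pi_gt0 R.
have dl10 : dl 1 - dl 0 = 2 * pi * (n - n')%:~R.
  by rewrite /dl intrB mulrBr -thn -th'n; ring.
have half v : (v = dl 0 + pi) \/ (v = dl 0 - pi) ->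
    Num.min (dl 0) (dl 1) <= v <= Num.max (dl 0) (dl 1) -> False.
  move=> vE /(IVT ler01 cdl)[t]; rewrite in_itv /= => t01 dlt.
  have := cosdl t t01; rewrite dlt.
  have c0 : cos (dl 0) = 1 by apply: cosdl; rewrite lexx ler01.
  have -> : cos v = -1.
    case: vE => ->; first by rewrite cosDpi c0.
    by have := cosDpi (dl 0 - pi); rewrite subrK c0; lra.
  by lra.
have [lt|gt|/eqP eq] := ltgtP n n'; last by apply/eqP.
- exfalso; apply: (half (dl 0 - pi)); first by right.
  have : (n - n')%:~R <= -1 :> R by rewrite -(mulrN1z 1) ler_int; lia.
  rewrite -(ler_pM2l (x := 2 * pi)) ?mulr_gt0 // -dl10 => h.
  by rewrite ge_min le_max; apply/andP; split; apply/orP; [right|left]; lra.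
- exfalso; apply: (half (dl 0 + pi)); first by left.
  have : 1 <= (n - n')%:~R :> R by rewrite -[1]/(1%:~R) ler_int; lia.
  rewrite -(ler_pM2l (x := 2 * pi)) ?mulr_gt0 // -dl10 => h.
  by rewrite ge_min le_max; apply/andP; split; apply/orP; [left|right]; lra.
Qed.

Lemma local_degree_unique f s (n n' : int) : local_degree f s n -> local_degree f s n' -> n = n'.
Proof.
move=> fn fn'; have [b [z sz]] := chart_surj s; have [b' [w fsw]] := chart_surj (f s).
have H : \forall r \near (0 : R)^'+,
    winding_number (fun t => in_charts b b' f (circle z r t)) w n /\
    winding_number (fun t => in_charts b b' f (circle z r t)) w n'.
  by near=> r; split; near: r; [exact: fn|exact: fn'].
have [r [h h']] := @filter_ex _ _ (at_right_proper_filter (0 : R)) _ H; exact: winding_unique h h'.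
Unshelve. all: by end_near. Qed.

Lemma winding_number_conj (gamma : R -> R[i]) w (n : int) :
  winding_number gamma w n -> winding_number (fun t => (gamma t)^*%C) w^*%C (- n).
Proof.
move=> [gw [th [cth thE thn]]]; split.
  by move=> t /gw; apply: contra_neq => /(can_inj (@conjcK R)).
exists (fun t => - th t); split.
- by move=> x; apply: continuousN; exact: cth.
- move=> t t01; rewrite -rmorphB.
  apply: (@polar_norm _ (normc (gamma t - w))); first exact: normc_ge0.
  rewrite {1}thE // normcE rmorphM /= oppr0; congr (_ * _).
  by rewrite /cis cosN sinN.
- by rewrite -opprD thn intrN mulrN.
Qed.

Lemma local_degree_conj f s (n : int) : local_degree f s n ->
  local_degree (@conj_sphere R \o f) s (- n).
Proof.
move=> fn b b' z w sz; rewrite /= -conj_chart => fsw.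
have {}fsw : chart b' (f s) = Some w^*%C by rewrite -[LHS]conj_sphereK fsw.
apply: filterS (fn b b' z _ sz fsw) => r /winding_number_conj; rewrite conjcK.
congr winding_number; apply/funext => t; rewrite /in_charts /= -conj_chart.
by case: (chart b' _) => [//|]; exact: conjc0.
Qed.

(** In charts the displacement is [D u / (1 + k u)]. The argument of [D] is constant, that of [u]
    gains one turn, and for small [r] the denominator stays in the right half-plane, where its
    argument returns to the start. *)
Lemma isMob_orientation_preserving m : isMob m -> orientation_preserving m.
Proof.
move=> mm s b b' z w sz msw.
have mz : (chart b' \o m \o chart b) (Some z) = Some w by rewrite /= -sz chartK.
have [D [k [D0 mE]]] := isMob_local (isMob_in_charts b b' mm) mz.
have [a aE] := polar D.
have k1 : 0 < normc k + 1 by rewrite ltr_wpDl ?normc_ge0.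
near=> r.
have r0 : 0 < r by near: r; exact: nbhs_right_gt.
have kr : normc k * r < 1.
  have : r < (normc k + 1)^-1 by near: r; apply: nbhs_right_lt; rewrite invr_gt0.
  rewrite -[X in _ < X]mul1r ltr_pdivlMr // mulrDr mulr1 mulrC; apply: lt_trans.
  by rewrite ltrDl.
pose u t : R[i] := r%:C * cis (2 * pi * t).
pose v t := 1 + k * u t.
have vRe t : 0 < Re (v t).
  have : normc (k * u t) < 1.
    by rewrite /u !Normc.normcM normc_cis mulr1 normc_real gtr0_norm.
  move=> /(le_lt_trans (normc_Re _)); rewrite ltr_norml => /andP[h _].
  by rewrite /v raddfD /=; lra.
have v0 t : v t != 0.
  by apply: contraTneq (vRe t) => ->; rewrite ltxx.
have gE t : in_charts b b' m (circle z r t) - w = hom_quot D k (u t) * u t.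
  rewrite /in_charts /circle -/(u t).
  by have /= -> := mE (u t) (v0 t); rewrite /= [w + _]addrC addrK.
have u0 t : u t != 0.
  by rewrite mulf_neq0 ?cis_neq0 // eq_complex /= gt_eqF.
split.
  by move=> t _; rewrite -subr_eq0 gE mulf_neq0 // mulf_neq0 // invr_neq0 //; exact: v0.
exists (fun t => a + 2 * pi * t - atan (Im (v t) / Re (v t))); split.
- apply: continuous_subspaceT => t.
  (* Expanded in sines and cosines, so that continuity concerns real functions only. *)
  have vE : (fun t => Im (v t) / Re (v t)) = (fun t =>
      (r * (Re k * sin (2 * pi * t) + Im k * cos (2 * pi * t))) /
      (1 + r * (Re k * cos (2 * pi * t) - Im k * sin (2 * pi * t)))).
    by apply/funext => t'; rewrite /v /u; case: (k) => x y /=; congr (_ / _); ring.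
  have c1 : {for t, continuous (fun t : R => 2 * pi * t)}.
    by apply: (@for_M R); [exact: for_cst|exact: for_id].
  have cc : {for t, continuous (fun t : R => cos (2 * pi * t))}.
    by apply: (@for_comp R cos) => //; exact: continuous_cos.
  have cs : {for t, continuous (fun t : R => sin (2 * pi * t))}.
    by apply: (@for_comp R sin) => //; exact: continuous_sin.
  suff : {for t, continuous (fun t : R => a + 2 * pi * t - atan (Im (v t) / Re (v t)))} by [].
  apply: (@for_B R).
    by apply: (@for_D R) => //; exact: for_cst.
  apply: (@for_comp R atan); last exact: continuous_atan.
  have := vRe t; have := congr1 (@^~ t) vE => /=; rewrite vE => _ vt.
  apply: (@for_M R).
    apply: (@for_M R); first exact: for_cst.
    by apply: (@for_D R); apply: (@for_M R) => //; exact: for_cst.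
  apply: (@for_V R).
    rewrite gt_eqF // (lt_le_trans vt) // le_eqVlt; apply/orP; left; apply/eqP.
    by rewrite /v /u; case: (k) => x y /=; ring.
  apply: (@for_D R); first exact: for_cst.
  apply: (@for_M R); first exact: for_cst.
  by apply: (@for_B R); apply: (@for_M R) => //; exact: for_cst.
- move=> t _; rewrite gE.
  apply: (@polar_norm _ (normc D * r / normc (v t))).
    by rewrite divr_ge0 ?normc_ge0 // mulr_ge0 ?normc_ge0 // ltW.
  rewrite /hom_quot -/(v t) {1}aE {1}(polar_right (vRe t)) !cisD cisN !normcE /u.
  rewrite !rmorphM fmorphV /=; field.
  by rewrite cis_neq0 fmorph_eq0 normc_eq0; exact: v0.
- have -> : v 1 = v 0 by rewrite /v /u mulr1 mulr0 cis2pi cis0.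
  by rewrite mulr0 mulr1; ring.
Unshelve. all: by end_near. Qed.

End Winding.

(** * Sandwich semigroups *)

Section SphereAutomorphisms.
Variable R : realType.
Local Notation C := R[i]^o.
Implicit Types (b : bool) (z w : R[i]) (s t : sphere R) (f g h m : sphere R -> sphere R).
Local Notation normc := (@Normc.normc R).
Local Notation conj := (@conj_sphere R).

(** Rationals are fixed by algebra, reals by density and continuity, and the image of ['i] is a
    square root of -1. *)
Lemma continuous_field_endomorphism (phi : R[i] -> R[i]) :
  {morph phi : x y / x + y} -> {morph phi : x y / x * y} -> phi 1 = 1 ->
  continuous (phi : C -> C) -> phi =1 id \/ phi =1 conjc.
Proof.
move=> phiD phiM phi1 cphi.
have phi0 : phi 0 = 0 by apply: (addrI (phi 0)); rewrite -phiD !addr0.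
have phiB : {morph phi : x y / x - y}.
  by move=> x y; apply/eqP; rewrite eq_sym subr_eq -phiD subrK.
have phiQ (q : rat) : phi (ratr q) = ratr q.
  pose aM := GRing.isZmodMorphism.Build R[i] R[i] phi phiB.
  pose mM := GRing.isMonoidMorphism.Build R[i] R[i] phi (phi1, phiM).
  pose Phi : {rmorphism R[i] -> R[i]} := HB.pack phi aM mM.
  exact: (fmorph_rat Phi).
have phiR (x : R) : phi x%:C = x%:C.
  apply/eqP; rewrite -subr_eq0 -normc_eq0 eq_le normc_ge0 andbT.
  apply/ler_addgt0Pr => e e0; rewrite add0r.
  have [dl dl0 h] := proj1 (continuousCP _ _) (cphi x%:C) (e / 2) ltac:(by rewrite divr_gt0).
  have m0 : 0 < Num.min dl (e / 2) by rewrite lt_min dl0 divr_gt0.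
  have [|q] := @rat_in_itvoo R x (x + Num.min dl (e / 2)); first by rewrite ltrDl.
  rewrite in_itv /= -ltrBlDl lt_min => /and3P[q0 q1 q2].
  have qC : (ratr q)%:C = ratr q :> R[i] by exact: fmorph_rat.
  have nq : normc (ratr q - x%:C) = ratr q - x.
    by rewrite -qC -rmorphB normc_real ger0_norm // subr_ge0 ltW.
  have := h (ratr q); rewrite nq phiQ => /(_ q1) hq.
  have := normcD (phi x%:C - ratr q) (ratr q - x%:C).
  by rewrite addrA subrK nq (normcB (phi _) (ratr q)); lra.
have phii : phi 'i%C = 'i%C \/ phi 'i%C = - 'i%C.
  have : phi 'i%C ^+ 2 = 'i%C ^+ 2.
    by rewrite expr2 -phiM -expr2 sqr_i -[-1]sub0r phiB phi0 phi1.
  by move/eqP; rewrite eqf_sqr => /orP[] /eqP; [left|right].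
case: phii => phii; [left|right] => z; rewrite [z]complexE phiD phiM !phiR phii //.
by case: z => x y /=; apply/eqP; rewrite eq_complex /=; apply/andP; split; apply/eqP; ring.
Qed.

Lemma conjugation_rigidity f f' : cancel f f' -> cancel f' f -> continuous f ->
  (forall g, isMob g -> RatMaps (f \o g \o f')) ->
  isMob f \/ isMob (conj \o f).
Proof.
move=> fK f'K cf ratf.
have [m [mm m0 moo]] : exists m, [/\ isMob m, m (f (Some 0)) = Some 0 & m (f None) = None].
  by apply: mob_to0oo; apply/eqP => /(can_inj fK).
have mfi : injective (m \o f) by apply: inj_comp (isMob_inj mm) (can_inj fK).
have [v v0 mf1] : exists2 v, v != 0 & m (f (Some 1)) = Some v.
  case mf1 : (m (f (Some 1))) => [v|].
    exists v => //; apply/eqP => v0.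
    have /mfi [/eqP] : (m \o f) (Some 1) = (m \o f) (Some 0) by rewrite /= mf1 m0 v0.
    by rewrite oner_eq0.
  by have /mfi : (m \o f) (Some 1) = (m \o f) None by rewrite /= mf1 moo.
pose n := mob v^-1 0 0 1 \o m.
have mn : isMob n by apply: isMob_comp => //; apply: isMob_affine; rewrite invr_neq0.
have [n' [mn' nK n'K]] := isMob_inv mn.
pose F := n \o f; pose F' := f' \o n'.
have FK : cancel F F' by move=> s; rewrite /F /F' /= nK fK.
have F0 : F (Some 0) = Some 0 by rewrite /F /n /= m0 mob_affine mulr0 addr0.
have F1 : F (Some 1) = Some 1 by rewrite /F /n /= mf1 mob_affine mulVf // addr0.
have Foo : F None = None by rewrite /F /n /= moo mob_affineoo.
have F'0 : F' (Some 0) = Some 0 by rewrite -{1}F0 FK.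
have F'oo : F' None = None by rewrite -{1}Foo FK.
have Finj := can_inj FK.
have F'inj : injective F' by apply: inj_comp (can_inj f'K) (can_inj n'K).
have ratF g : isMob g -> RatMaps (F \o g \o F').
  move=> mg; have := RatMaps_mobl mn (RatMaps_mobr mn' (ratf g mg)); exact.
pose phi z := odflt 0 (F (Some z)).
have FE z : F (Some z) = Some (phi z).
  rewrite /phi; case Fz : (F (Some z)) => //.
  by have /Finj : F (Some z) = F None by rewrite Fz Foo.
have phi1 : phi 1 = 1 by rewrite /phi F1.
have phi0 : phi 0 = 0 by rewrite /phi F0.
have phi_inj : injective phi.
  by move=> x y xy; have /Finj[] : F (Some x) = F (Some y) by rewrite !FE xy.
have phiM : {morph phi : x y / x * y}.
  move=> a z; have [->|a0] := eqVneq a 0; first by rewrite !mul0r phi0 mul0r.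
  have ma := @isMob_affine R a 0 a0.
  have [||||c c0 cE] := @RatMaps_inj_normal R (F \o mob a 0 0 1 \o F').
  - exact: ratF.
  - by apply: inj_comp => //; apply: inj_comp => //; exact: isMob_inj.
  - by rewrite /= F'0 mob_affine mulr0 addr0.
  - by rewrite /= F'oo mob_affineoo.
  have step w : phi (a * w) = c * phi w.
    have := congr1 (@^~ (F (Some w))) cE.
    by rewrite /= FK mob_affine addr0 !FE mob_affine addr0 => -[].
  have ca : phi a = c by have := step 1; rewrite mulr1 phi1 mulr1.
  by rewrite step ca.
(* Obtained from multiplicativity alone, as it is needed to establish additivity. *)
have phiN1 : phi (-1) = -1.
  have : phi (-1) ^+ 2 == 1 ^+ 2 by rewrite expr2 -phiM mulrNN mulr1 phi1 expr1n.
  rewrite eqf_sqr => /orP[/eqP h|/eqP //].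
  have /eqP : -1 = 1 :> R[i] by apply: phi_inj; rewrite h phi1.
  by rewrite -subr_eq0 -opprD oppr_eq0 -[1 + 1]/(2%:R) pnatr_eq0.
have phiD : {morph phi : x y / x + y}.
  move=> z b; have [->|b0] := eqVneq b 0; first by rewrite phi0 !addr0.
  pose m1 := mob 1 (- phi b) 0 1 \o (F \o mob 1 b 0 1 \o F').
  have mt u : isMob (mob 1 u 0 1 : sphere R -> sphere R) by apply: isMob_affine; exact: oner_neq0.
  have [||||c c0 cE] := @RatMaps_inj_normal R m1.
  - by apply: RatMaps_mobl => //; exact: ratF.
  - apply: inj_comp; first exact: isMob_inj.
    by apply: inj_comp => //; apply: inj_comp => //; exact: isMob_inj.
  - by rewrite /m1 /= F'0 mob_affine mul1r add0r FE mob_affine mul1r subrr.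
  - by rewrite /m1 /= F'oo mob_affineoo Foo mob_affineoo.
  have step w : phi (w + b) = c * phi w + phi b.
    have := congr1 (@^~ (F (Some w))) cE.
    rewrite /m1 /= FK mob_affine mul1r !FE !mob_affine mul1r addr0 => -[<-].
    by rewrite subrK.
  (* A translation is so far known to become an affine map with factor [c]; evaluating at [- b],
     where [phi (- b) = - phi b], shows that it is a translation. *)
  have c1 : c = 1.
    have pb0 : phi b != 0 by rewrite -phi0; apply: contra_neq b0 => /phi_inj.
    have := step (- b); rewrite addNr phi0 -mulN1r phiM phiN1 mulN1r mulrN => /esym/eqP.
    by rewrite addrC subr_eq0 => /eqP h; apply: (mulIf pb0); rewrite mul1r.
  by rewrite step c1 mul1r.
have cF : continuous F by move=> s; apply: continuous_comp; [exact: cf|exact: isMob_continuous].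
have cphi : continuous (phi : C -> C).
  move=> z U nU; have := cF (Some z) (fun s => if s is Some w then U w else True).
  rewrite FE => /(_ nU); rewrite nbhs_simpl /= nbhs_Some.
  have FF : Filter (nbhs (z : C)) by exact: nbhs_filter.
  change (nbhs (z : C) (fun w => if F (Some w) is Some w0 then U w0 else True) ->
    nbhs (z : C) (fun w => U (phi w))).
  by apply: filterS => w; rewrite FE.
have fE : f = n' \o F by apply/funext => s; rewrite /F /= nK.
have [pid|pconj] := continuous_field_endomorphism phiD phiM phi1 cphi; [left|right].
  rewrite fE (_ : F = id) //; apply/funext => -[z|] //.
  by rewrite FE pid.
rewrite fE (_ : F = conj); first exact: isMob_conj.
by apply/funext => -[z|] //; rewrite FE pconj.
Qed.

End SphereAutomorphisms.

(** * From isomorphisms to homographies and back *)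

Section Sandwich.
Variable R : realType.
Implicit Types (s t : sphere R) (f g h m A B : sphere R -> sphere R).
Local Notation conj := (@conj_sphere R).

Lemma conjK_comp f : conj \o (conj \o f) = f.
Proof. by apply/funext => s /=; rewrite conj_sphereK. Qed.

Lemma isMob_conj_left f : isMob (conj \o f) -> isMob (f \o conj).
Proof. by move=> /isMob_conj; rewrite conjK_comp. Qed.

(* [sg] tells whether the orientation is reversed. *)
Definition isHom (sg : bool) f := if sg then isMob (conj \o f) else isMob f.

Lemma isHom_inv sg f : isHom sg f -> exists f', [/\ isHom sg f', cancel f f' & cancel f' f].
Proof.
case: sg => /= [/[dup] mf /isMob_inv[g [mg gK g'K]]|/isMob_inv //].
exists (g \o conj); split.
- exact: isMob_conj mg.
- by move=> s; have := gK s.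
- by move=> s; have := g'K (conj s); move/(congr1 conj) => /=; rewrite !conj_sphereK.
Qed.

Lemma isHom_comp sg sg' f g : isHom sg f -> isHom sg' g -> isHom (sg (+) sg') (f \o g).
Proof.
case: sg sg' => -[] /= mf mg.
- have -> : f \o g = (f \o conj) \o (conj \o g).
    by apply/funext => s /=; rewrite conj_sphereK.
  exact: isMob_comp (isMob_conj_left mf) mg.
- exact: isMob_comp mf mg.
- have -> : conj \o (f \o g) = (conj \o f \o conj) \o (conj \o g).
    by apply/funext => s /=; rewrite conj_sphereK.
  exact: isMob_comp (isMob_conj mf) mg.
- exact: isMob_comp.
Qed.

Lemma isHom_continuous sg f : isHom sg f -> continuous f.
Proof.
case: sg => /= [mf|]; last exact: isMob_continuous.
rewrite -(conjK_comp f) => s; apply: continuous_comp; first exact: isMob_continuous.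
exact: continuous_conj_sphere.
Qed.

Lemma isHom_orientation sg f : isHom sg f ->
  if sg then orientation_reversing f else orientation_preserving f.
Proof.
case: sg => /= [mf|]; last exact: isMob_orientation_preserving.
rewrite -(conjK_comp f) => s; apply: local_degree_conj.
exact: isMob_orientation_preserving.
Qed.

(** In the reversing case two conjugations are inserted: [conj \o g \o conj] is rational with
    conjugate coefficients, and the outer factors become homographies. *)
Lemma isHom_RatMaps sg f g h : isHom sg f -> isHom sg h -> RatMaps g -> RatMaps (f \o g \o h).
Proof.
case: sg => /= mf mh rg; last by apply: RatMaps_mobr => //; exact: RatMaps_mobl.
have -> : f \o g \o h = (f \o conj) \o (conj \o g \o conj) \o (conj \o h).
  by apply/funext => s /=; rewrite !conj_sphereK.
apply: RatMaps_mobr => //; apply: RatMaps_mobl; first exact: isMob_conj_left.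
exact: RatMaps_conj.
Qed.

(** Between two images stands [B \o R2 \o A], that is [R1]: this is multiplicativity. On constants
    only [A] remains visible. *)
Lemma sandwich_iso sg A B (R1 R2 : sphere R -> sphere R) : isHom sg A -> isHom sg B -> B \o R2 \o A = R1 ->
  continuous_isomorphism R1 R2 (fun h => A \o h \o B) /\
  induced_on_constants (fun h => A \o h \o B) A.
Proof.
move=> hA hB eR; split; last by [].
have [A' [hA' AK A'K]] := isHom_inv hA; have [B' [hB' BK B'K]] := isHom_inv hB.
split; last first.
  exact: continuous_subspaceT (comp_compact_open_continuous (isHom_continuous hA) (isHom_continuous hB)).
split.
  split.
  - by move=> h rh; exact: isHom_RatMaps hA hB rh.
  - move=> h h' _ _ e; apply/funext => s; have := congr1 (fun k => A' (k (B' s))) e.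
    by rewrite /= !AK B'K.
  - move=> h rh; exists (A' \o h \o B'); first exact: isHom_RatMaps hA' hB' rh.
    by apply/funext => s /=; rewrite A'K BK.
by move=> g1 g2 _ _; rewrite /sandwich -eR.
Qed.

Lemma iso_structure (R1 R2 : sphere R -> sphere R) rho f : RatMaps R2 -> nonconstant R2 ->
  continuous_isomorphism R1 R2 rho -> induced_on_constants rho f ->
  [/\ isMob (rho id), f \o R1 = rho id \o R2 \o f & exists sg, isHom sg f].
Proof.
move=> rR2 ncR2 crho rhof; have cf := induced_continuous crho rhof.
move: crho => [[[rhoR rhoI rhoS] rhoM] _].
have cstI s t : cst s = cst t :> (sphere R -> sphere R) -> s = t.
  by move=> e; have := congr1 (@^~ s) e.
have finj : injective f.
  move=> s t st; apply: cstI; apply: rhoI; rewrite ?inE; try exact: RatMaps_cst.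
  by rewrite !rhof st.
have fsurj t : exists s, f s = t.
  have [h rh ht] := rhoS (cst t) (RatMaps_cst t).
  (* Since [cst t] absorbs on the right, [h] and its product with a constant have the same image;
     injectivity of [rho] makes [h] constant. *)
  have hE : cst (h (R1 None)) = h.
    apply: rhoI; rewrite ?inE //; first exact: RatMaps_cst.
    rewrite (_ : cst (h (R1 None)) = sandwich R1 h (cst None)) // rhoM //; last exact: RatMaps_cst.
    by rewrite ht.
  by exists (h (R1 None)); apply: cstI; rewrite -rhof hE.
have [f' fK f'K] : exists2 f', cancel f f' & cancel f' f.
  have /choice[f' f'K] := fsurj; exists f' => // s.
  by apply: finj; rewrite f'K.
have main g : RatMaps g -> f \o g \o R1 = rho g \o R2 \o f.
  move=> rg; apply/funext => s; apply: cstI.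
  rewrite -(rhof _) (_ : cst ((g \o R1) s) = sandwich R1 g (cst s)) //.
  by rewrite rhoM // ?rhof //; exact: RatMaps_cst.
have rid := RatMaps_id R.
have mid := main id rid.
have conjE g : RatMaps g -> f \o g \o f' \o rho id = rho g.
  move=> rg; apply/funext => t; have [s' s'E] := RatMaps_surj rR2 ncR2 t.
  have [s sE] := fsurj s'; rewrite -s'E -sE.
  have := congr1 (@^~ s) mid; rewrite /= => <-; rewrite fK.
  by have := congr1 (@^~ s) (main g rg).
have mP : isMob (rho id).
  apply: RatMaps_inj_mob; first exact: rhoR.
  have [g rg gid] := rhoS id rid.
  have := conjE g rg; rewrite gid => e s t st.
  by have := congr1 (@^~ s) e; have := congr1 (@^~ t) e; rewrite /= st => ->.
split=> //.
have [P' [mP' PK P'K]] := isMob_inv mP.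
have ratf g : isMob g -> RatMaps (f \o g \o f').
  move=> mg; have rg := RatMaps_mob mg.
  (* Cancelling the homography [rho id] shows that the conjugate of [g] is rational. *)
  have -> : f \o g \o f' = rho g \o P'.
    by rewrite -(conjE g rg); apply/funext => s /=; rewrite P'K.
  by apply: RatMaps_mobr => //; exact: rhoR.
by have [mf|mf] := conjugation_rigidity fK f'K cf ratf; [exists false|exists true].
Qed.

Lemma preserves_orientationP sg f : isHom sg f -> orientation_preserving f -> isMob f.
Proof.
case: sg => // /isHom_orientation h h'.
by have := local_degree_unique (h None) (h' None).
Qed.

Lemma reverses_orientationP sg f : isHom sg f -> orientation_reversing f -> isMob (conj \o f).
Proof.
case: sg => // /isHom_orientation h h'.
by have := local_degree_unique (h None) (h' None).
Qed.

End Sandwich.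

Theorem theorem15 (R : realType) (R1 R2 : sphere R -> sphere R)
  (ratR1 : RatMaps R1) (ratR2 : RatMaps R2)
  (ncR1 : nonconstant R1) (ncR2 : nonconstant R2) :
  ((same_conformal_hurwitz_class R1 R2 <->
      exists rho : sphere_maps R -> sphere_maps R,
        continuous_isomorphism R1 R2 rho /\ preserves_orientation rho)
   /\
   ((exists rho : sphere_maps R -> sphere_maps R,
       [/\ continuous_isomorphism R1 R2 rho, preserves_orientation rho
         & rho id = id]) <->
    PSL2_conjugate R1 R2))
  /\
  (((exists rho : sphere_maps R -> sphere_maps R,
       continuous_isomorphism R1 R2 rho /\ reverses_orientation rho) <->
    anticonformal_copy R1 R2)
   /\
   ((exists rho : sphere_maps R -> sphere_maps R,
       [/\ continuous_isomorphism R1 R2 rho, reverses_orientation rho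
         & rho id = id]) <->
    anticonformally_conjugate R1 R2)).
Proof.
have iso1 g g' h : PSL2 g -> PSL2 h -> cancel g g' -> cancel g' g -> R2 = g' \o R1 \o h ->
    exists h', [/\ cancel h h', cancel h' h,
      continuous_isomorphism R1 R2 (fun k => h' \o k \o g) & preserves_orientation (fun k => h' \o k \o g)].
  move=> /PSL2P mg /PSL2P mh gK g'K R2E.
  have [h' [mh' hK h'K]] := isMob_inv mh.
  have [|ci ind] := @sandwich_iso R false h' g R1 R2 mh' mg.
    by rewrite R2E; apply/funext => s /=; rewrite h'K g'K.
  exists h'; split=> //; exists h'; split=> //.
  exact: isMob_orientation_preserving.
have iso2 al be : anticonformal_homeomorphism al -> anticonformal_homeomorphism be ->
    be \o R1 = R2 \o al -> exists be', [/\ cancel be be', cancel be' be,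
      continuous_isomorphism R1 R2 (fun k => al \o k \o be') & reverses_orientation (fun k => al \o k \o be')].
  move=> /anticonformalP mal /anticonformalP mbe e.
  have [be' [mbe' bK b'K]] := @isHom_inv R true be mbe.
  have [|ci ind] := @sandwich_iso R true al be' R1 R2 mal mbe'.
    by apply/funext => s; have /= <- := congr1 (@^~ s) e; rewrite bK.
  exists be'; split=> //; exists al; split=> //.
  exact: (@isHom_orientation R true).
have inv1 rho : continuous_isomorphism R1 R2 rho -> preserves_orientation rho ->
    exists f f', [/\ isMob f, isMob f', cancel f f', cancel f' f & isMob (rho id) /\ f \o R1 = rho id \o R2 \o f].
  move=> ci [f [ind ori]]; have [mP e [sg hf]] := iso_structure ratR2 ncR2 ci ind.
  have mf := preserves_orientationP hf ori.
  by have [f' [mf' fK f'K]] := isMob_inv mf; exists f, f'.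
have inv2 rho : continuous_isomorphism R1 R2 rho -> reverses_orientation rho ->
    exists2 f, isMob (@conj_sphere R \o f) & isMob (rho id) /\ f \o R1 = rho id \o R2 \o f.
  move=> ci [f [ind ori]]; have [mP e [sg hf]] := iso_structure ratR2 ncR2 ci ind.
  by exists f => //; exact: reverses_orientationP hf ori.
split; split; split.
- move=> [g [g' [h [Pg Ph gK g'K R2E]]]].
  have [h' [_ _ ci ori]] := iso1 g g' h Pg Ph gK g'K R2E.
  by exists (fun k => h' \o k \o g).
- move=> [rho [ci ori]]; have [f [f' [mf mf' fK f'K [mP e]]]] := inv1 rho ci ori.
  have [P' [mP' PK P'K]] := isMob_inv mP.
  (* Solving [f \o R1 = rho id \o R2 \o f] for [R2] gives [R2 = (P' \o f) \o R1 \o f']. *)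
  exists (f' \o rho id), (P' \o f), f'; split.
  + by apply/PSL2P; exact: isMob_comp.
  + exact/PSL2P.
  + by move=> s /=; rewrite f'K PK.
  + by move=> s /=; rewrite P'K fK.
  + apply/funext => s /=; have /= -> := congr1 (@^~ (f' s)) e.
    by rewrite f'K PK.
- move=> [rho [ci ori rid]]; have [f [f' [mf mf' fK f'K [_ e]]]] := inv1 rho ci ori.
  exists f', f; split=> //; first exact/PSL2P.
  by apply/funext => s /=; have /= -> := congr1 (@^~ (f' s)) e; rewrite rid f'K.
- move=> [g [g' [Pg gK g'K R2E]]].
  (* With equal homographies on both sides, the image of [id] is [g^-1 \o g]. *)
  have [h' [hK h'K ci ori]] := iso1 g g' g Pg Pg gK g'K R2E.
  exists (fun k => h' \o k \o g); split=> //.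
  by apply/funext => s /=; rewrite hK.
- move=> [rho [ci ori]]; have [f mf [mP e]] := inv2 rho ci ori.
  have [P' [mP' PK P'K]] := isMob_inv mP.
  (* Moving [rho id] to the left of the intertwining relation gives [beta]; it reverses orientation
     as [f] does. *)
  exists f, (P' \o f); split; first exact/anticonformalP.
    by apply/anticonformalP; exact: (@isHom_comp R false true P' f).
  by apply/funext => s /=; have /= -> := congr1 (@^~ s) e; rewrite PK.
- move=> [al [be [hal hbe e]]]; have [be' [_ _ ci ori]] := iso2 al be hal hbe e.
  by exists (fun k => al \o k \o be').
- move=> [rho [ci ori rid]]; have [f mf [_ e]] := inv2 rho ci ori.
  exists f; split; first exact/anticonformalP.
  by rewrite e rid.
- move=> [al [hal e]]; have [be' [bK b'K ci ori]] := iso2 al al hal hal e.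
  exists (fun k => al \o k \o be'); split=> //.
  by apply/funext => s /=; rewrite b'K.
Qed.
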